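(* Let $p\in(0,1]$ and let $M_1,M_2$ be functions on $[0,1]$ such that $t\mapsto M_1(t^{1/p})$ and $t\mapsto M_2(t^{1/p})$ are Orlicz functions, with fundamental functions $\varphi_{M_1},\varphi_{M_2}$. Let $(\alpha_i)_{i=1}^\infty$ be a non-increasing sequence of non-negative real numbers for which there is a constant $C\ge1$ such that $\alpha_i\le C\alpha_{2i}$ for every $i\in\mathbb{N}$. Let $T_\alpha:\ell_{M_1}\to\ell_{M_2}$, $T_\alpha((x_i)_{i=1}^\infty)=(\alpha_ix_i)_{i=1}^\infty$, be the diagonal operator generated by $(\alpha_i)$. For $k\in\mathbb{N}$ set $$\Lambda(k):=\max_{s\in\{1,\dots,k\}}\alpha_{k2^{s-1}}\frac{\varphi_{M_2}(k/s)}{\varphi_{M_1}(k/s)}.$$ If $\varphi_{M_1}/\varphi_{M_2}$ is non-decreasing on $[1,\infty)$, then for every $k\in\mathbb{N}$, $$c_1(p)\,\Lambda(k)\le e_k(T_\alpha)\le c_2(p,C)\,\Lambda(k),$$ where $$c_1(p)=4^{-2}\,2^{-21/p}\left(\log\tfrac{24}{p}\right)^{-2/p}\left(\tfrac1p\right)^{-1/p},$$ $$c_2(p,C)=4\,C\,2^{22/p}\,2^{14C}\left(\log\left(24(1/p+C)\right)\right)^{2(1/p+C)}\left(1/p+C\right)^{1/p+C}.$$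
   Context: All spaces are real; $\log=\log_2$; $\mathbb{N}=\{1,2,\dots\}$. Orlicz function: a continuous, strictly increasing, convex function $N:[0,1]\to\mathbb{R}$ with $N(0)=0$, $N(1)=1$. Orlicz sequence space: for $M$ on $[0,1]$ such that $t\mapsto M(t^{1/p})$ is an Orlicz function for some $p\in(0,1]$, $\ell_M=\{x=(x_i)_{i=1}^\infty:\ \sum_i M(|x_i|/\varrho)<\infty\text{ for some }\varrho>0\}$ with the $p$-norm $\|x\|_{\ell_M}=\inf\{\varrho>0:\ \sum_{i} M(|x_i|/\varrho)\le 1\}$. Convention: $M(t)=+\infty$ for $t>1$, so only $\varrho$ with $|x_i|\le\varrho$ for all $i$ are admissible. Fundamental function: $\varphi_M(t)=1/M^{-1}(1/t)$ for $t\ge1$. Entropy numbers: for a continuous linear map $T:X\to Y$ between quasi-Banach spaces with closed unit balls $B_X,B_Y$, $e_k(T)=\inf\{\varepsilon>0:\ T(B_X)\subset\bigcup_{i=1}^{2^{k-1}}(y_i+\varepsilon B_Y)\text{ for some }y_1,\dots,y_{2^{k-1}}\in Y\}$. *)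

(* Defs.v *)
From HB Require Import structures.
From mathcomp Require Export all_boot all_order all_algebra.
From mathcomp Require Export all_classical all_reals all_analysis.

Set Implicit Arguments.
Unset Strict Implicit.
Unset Printing Implicit Defensive.

Import Order.TTheory GRing.Theory Num.Theory.
Import numFieldNormedType.Exports.

Local Open Scope classical_set_scope.
Local Open Scope ring_scope.

Section Defs.
Context {R : realType}.

Definition log2 (x : R) : R := ln x / ln 2.

(* Functions "on [0,1]" are total functions [R -> R] of which only the values
   on [0,1] are ever used. *)
Definition orlicz_function (N : R -> R) : Prop :=
  [/\ {within `[0, 1], continuous N},
      {in `[0, 1] &, {homo N : s t / s < t}},
      convex_function (`[0, 1]%classic : set R) N,
      N 0 = 0 & N 1 = 1].

Definition p_orlicz_function (p : R) (M : R -> R) : Prop :=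
  orlicz_function (fun t => M (t `^ p^-1)).

Definition orlicz_ext (M : R -> R) (t : R) : \bar R :=
  if t <= 1 then (M t)%:E else +oo%E.

(* Index shift: [x i] is the coordinate x_{i+1}. *)
Definition orlicz_modular (M : R -> R) (x : nat -> R) (rho : R) : \bar R :=
  (\sum_(0 <= i <oo) orlicz_ext M (`|x i| / rho))%E.

Definition orlicz_space (M : R -> R) : set (nat -> R) :=
  [set x | exists2 rho : R, 0 < rho & (orlicz_modular M x rho < +oo)%E].

(* Meaningful on [orlicz_space M] only (elsewhere the set is empty). *)
Definition orlicz_norm (M : R -> R) (x : nat -> R) : R :=
  inf [set rho | 0 < rho /\ (orlicz_modular M x rho <= 1)%E].

(* [pinv `[0, 1] M] is the inverse of the restriction of [M] to [0,1]. *)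
Definition fundamental_function (M : R -> R) (t : R) : R :=
  (pinv (`[0, 1]%classic : set R) M t^-1)^-1.

(* A space is given by a carrier [X] inside an ambient vector space, with a
   quasi-norm on [X]. *)
Definition unit_ball (E : lmodType R) (X : set E) (normX : E -> R) : set E :=
  [set x | X x /\ normX x <= 1].

(* The infimum is taken in the extended reals, so that it would be +oo if no
   finite eps were admissible, in particular if T did not map X into Y. *)
Definition entropy_number (E F : lmodType R) (X : set E) (normX : E -> R)
    (Y : set F) (normY : F -> R) (T : E -> F) (k : nat) : \bar R :=
  ereal_inf [set eps%:E | eps in [set eps : R | 0 < eps /\
    exists y : 'I_(2 ^ k.-1) -> F, (forall i, Y (y i)) /\
      T @` unit_ball X normX `<=`
        \bigcup_i [set y i + eps *: b | b in unit_ball Y normY]]].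

(* [alpha i] is alpha_i, used for [i >= 1] only. *)
Definition diagonal_operator (alpha : nat -> R) (x : nat -> R) : nat -> R :=
  fun i => alpha i.+1 * x i.

(* e_k of the diagonal operator from l_{M1} to l_{M2} *)
Definition diagonal_entropy_number (M1 M2 : R -> R) (alpha : nat -> R)
    (k : nat) : \bar R :=
  entropy_number (E := nat -> R) (F := nat -> R)
    (orlicz_space M1) (orlicz_norm M1) (orlicz_space M2) (orlicz_norm M2)
    (diagonal_operator alpha) k.

(* Seeding the iterated maximum with the term s = 1 makes it the true maximum
   over s in {1, ..., k}. *)
Definition Lambda (M1 M2 : R -> R) (alpha : nat -> R) (k : nat) : R :=
  let F (s : nat) := alpha (k * 2 ^ s.-1)%N *
    (fundamental_function M2 (k%:R / s%:R) /
     fundamental_function M1 (k%:R / s%:R)) in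
  \big[Num.max/F 1%N]_(1 <= s < k.+1) F s.

Definition c1 (p : R) : R :=
  4 ^- 2 * 2 `^ (- (21 / p)) * log2 (24 / p) `^ (- (2 / p))
  * p^-1 `^ (- p^-1).

Definition c2 (p C : R) : R :=
  4 * C * 2 `^ (22 / p) * 2 `^ (14 * C)
  * log2 (24 * (p^-1 + C)) `^ (2 * (p^-1 + C))
  * (p^-1 + C) `^ (p^-1 + C).

End Defs.

(* Main.v *)
(* Lower bound: a family of words, realised as coordinate vectors of the unit
   ball of l_{M1}, is separated in sufficiently many coordinates.  If two words
   lie in one ball of radius eps < delta * phi_{M2}(t), then fewer than 2t
   coordinates of their images differ by at least 2 delta, so the words are close
   in the Hamming distance, and counting Hamming balls excludes a covering by
   2^(k-1) balls.  For s < 8 it suffices to treat s = 1, with k coordinates taking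
   16 values each; for s >= 8 one uses 4 ceil(k/s) blocks of 2^(s-1) positions with
   one nonzero entry per block.

   Upper bound: the coordinate i in [k 2^(s-1), k 2^s) of the image is rounded to
   a multiple of K L / phi_{M2}(k/s), where L >= Lambda(k).  Monotonicity of
   phi_{M1} / phi_{M2} makes the modular of the rounding error at K L at most 2.
   The integer codes c_i that occur satisfy sum_i w_i(c_i) <= k/16 for weights w_i
   growing like c^p, so by an exponential moment estimate there are at most
   exp(k/4) of them.  For i < k the loss of alpha_i against alpha_k is
   polynomial in k/i by the doubling condition, and is absorbed in
   [doubling_scale]. *)

Require Import Defs.
From mathcomp Require Import ring lra zify.

Set Implicit Arguments.
Unset Strict Implicit.
Unset Printing Implicit Defensive.

Import Order.TTheory GRing.Theory Num.Theory.
Import numFieldNormedType.Exports.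
Local Open Scope classical_set_scope.
Local Open Scope ring_scope.

(** * Orlicz functions and their fundamental functions *)

Section OrliczFunctions.
Context {R : realType} (p : R) (M : R -> R).
Hypotheses (p_gt0 : 0 < p) (M_orlicz : p_orlicz_function p M).

Lemma powR_invK (x : R) : 0 <= x -> (x `^ p) `^ p^-1 = x.
Proof. by move=> x0; rewrite -powRrM mulfV ?gt_eqF// powRr1. Qed.

Lemma powR_Kinv (x : R) : 0 <= x -> (x `^ p^-1) `^ p = x.
Proof. by move=> x0; rewrite -powRrM mulVf ?gt_eqF// powRr1. Qed.

Lemma powR_unit_itv (x r : R) : 0 <= r -> x \in `[0, 1] -> x `^ r \in `[0, 1].
Proof.
move=> r0; rewrite !in_itv/= => /andP[x0 x1]; rewrite powR_ge0/=.
have : x `^ r <= 1 `^ r by rewrite ge0_ler_powR// nnegrE.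
by rewrite powR1.
Qed.

Lemma orlicz0 : M 0 = 0.
Proof. by case: M_orlicz => _ _ _ + _; rewrite powR0// invr_eq0 gt_eqF. Qed.

Lemma orlicz1 : M 1 = 1.
Proof. by case: M_orlicz => _ _ _ _; rewrite powR1. Qed.

Lemma orlicz_lt : {in `[0, 1] &, {homo M : s t / s < t}}.
Proof.
move=> s t s01 t01 st; case: M_orlicz => _ Ninc _ _ _.
have s0 : 0 <= s by move: s01; rewrite in_itv/= => /andP[].
have t0 : 0 <= t by exact: le_trans (ltW st).
rewrite -(powR_invK s0) -(powR_invK t0); apply: Ninc.
- exact: powR_unit_itv (ltW _) _.
- exact: powR_unit_itv (ltW _) _.
- by rewrite gt0_ltr_powR// ?nnegrE.
Qed.

Lemma orlicz_le : {in `[0, 1] &, {homo M : s t / s <= t}}.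
Proof.
move=> s t s01 t01; rewrite le_eqVlt => /predU1P[->//|st].
exact/ltW/orlicz_lt.
Qed.

Lemma orlicz_lt_mono : {in `[0, 1] &, {mono M : s t / s < t}}.
Proof.
move=> s t s01 t01; apply/idP/idP => [|st]; last exact: orlicz_lt.
by apply: contraLR; rewrite -!leNgt; exact: orlicz_le.
Qed.

Lemma orlicz_le_mono : {in `[0, 1] &, {mono M : s t / s <= t}}.
Proof. by move=> s t s01 t01; rewrite leNgt orlicz_lt_mono// -leNgt. Qed.

Lemma orlicz_unit_itv (t : R) : t \in `[0, 1] -> M t \in `[0, 1].
Proof.
move=> t01; have := t01; rewrite !in_itv/= => /andP[t0 t1].
by rewrite -{1}orlicz0 -orlicz1 !orlicz_le// in_itv/= lexx ler01.
Qed.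

Lemma orlicz_gt0 (t : R) : 0 < t -> t <= 1 -> 0 < M t.
Proof.
by move=> t0 t1; rewrite -orlicz0 orlicz_lt// in_itv/= ?lexx ?ler01 ?t1 ?ltW.
Qed.

(** Convexity of [M (t ^ (1/p))] on the segment from 0 to [t ^ p], with weight [l ^ p]; the value at
    0 vanishes. *)
Lemma orlicz_dilate (l t : R) : l \in `[0, 1] -> t \in `[0, 1] ->
  M (l * t) <= l `^ p * M t.
Proof.
move=> l01 t01; case: M_orlicz => _ _ Ncvx _ _.
have lp01 := powR_unit_itv (ltW p_gt0) l01.
have tp01 := powR_unit_itv (ltW p_gt0) t01.
move: (l01) (t01) (lp01); rewrite !in_itv/= => /andP[l0 _] /andP[t0 _].
move=> /andP[lp0 lp1].
have zero01 : (0 : R) \in `[0, 1] by rewrite in_itv/= lexx ler01.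
have := Ncvx (Itv01 lp0 lp1) (t `^ p) 0 (mem_set tp01) (mem_set zero01).
rewrite !convRE /= /conv/= scaler0 addr0 /=.
rewrite (_ : l `^ p *: t `^ p = (l * t) `^ p); last by rewrite powRM.
by rewrite !powR_invK ?mulr_ge0// powR0 ?invr_eq0 ?gt_eqF// orlicz0 mulr0 addr0.
Qed.

Lemma orlicz_surj (y : R) : y \in `[0, 1] -> exists2 t, t \in `[0, 1] & M t = y.
Proof.
move=> y01; case: M_orlicz => Ncont _ _ N0 N1.
have : Num.min (M (0 `^ p^-1)) (M (1 `^ p^-1)) <= y <=
       Num.max (M (0 `^ p^-1)) (M (1 `^ p^-1)).
  by rewrite N0 N1 min_l// max_r//; rewrite in_itv in y01.
move=> /(IVT (@ler01 R) Ncont)[t t01 Mt].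
exists (t `^ p^-1) => //; apply: powR_unit_itv => //.
by rewrite invr_ge0 ltW.
Qed.

Lemma orlicz_inj : {in `[0, 1] &, injective M}.
Proof.
move=> s t s01 t01 eqM; apply/le_anti/andP.
by split; rewrite -orlicz_le_mono// eqM.
Qed.

Local Notation phi := (fundamental_function M).

(** The intermediate value theorem gives a preimage of [1/t], and injectivity of [M] identifies it
    with the value of [pinv]. From here on [phi] is handled only through [M (1 / phi t) = 1/t]. *)
Lemma fundamental_spec (t : R) : 1 <= t -> [/\ 1 <= phi t,
  (phi t)^-1 \in `[0, 1] & M (phi t)^-1 = t^-1].
Proof.
move=> t1; have t0 : 0 < t := lt_le_trans ltr01 t1.
have ti01 : t^-1 \in `[0, 1].
  by rewrite in_itv/= invr_ge0 (ltW t0) invf_le1.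
have [u u01 Mu] := orlicz_surj ti01.
have Minv : pinv (`[0, 1]%classic : set R) M t^-1 = u.
  rewrite -Mu pinvKV//; first by move=> x y /set_mem xI /set_mem yI; exact: orlicz_inj.
  exact: mem_set.
have u0 : 0 < u.
  move: u01; rewrite in_itv/= le_eqVlt => /andP[/predU1P[u0|//] _].
  by move: Mu; rewrite -u0 orlicz0 => /esym/eqP; rewrite invr_eq0 gt_eqF.
rewrite /fundamental_function Minv invrK u01 Mu; split=> //.
by rewrite -[1]invr1 lef_pV2// ?posrE//; move: u01; rewrite in_itv => /andP[].
Qed.

Lemma fundamental_ge1 (t : R) : 1 <= t -> 1 <= phi t.
Proof. by case/fundamental_spec. Qed.

Lemma fundamental_gt0 (t : R) : 1 <= t -> 0 < phi t.
Proof. by move=> /fundamental_ge1; exact: lt_le_trans. Qed.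

Lemma fundamentalV_unit (t : R) : 1 <= t -> (phi t)^-1 \in `[0, 1].
Proof. by case/fundamental_spec. Qed.

Lemma orlicz_fundamentalV (t : R) : 1 <= t -> M (phi t)^-1 = t^-1.
Proof. by case/fundamental_spec. Qed.

Lemma fundamental_le : {in `[1, +oo[ &, {homo phi : s t / s <= t}}.
Proof.
move=> s t; rewrite !in_itv/= !andbT => s1 t1 st.
rewrite -lef_pV2 ?posrE ?fundamental_gt0// -orlicz_le_mono ?fundamentalV_unit//.
by rewrite !orlicz_fundamentalV// lef_pV2// posrE (lt_le_trans ltr01).
Qed.

(** After passing to inverses and applying [M], this is [orlicz_dilate] with factor [l ^ (-1/p)],
    whose p-th power is [1/l]. *)
Lemma fundamental_dilate (l t : R) : 1 <= l -> 1 <= t ->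
  phi (l * t) <= l `^ p^-1 * phi t.
Proof.
move=> l1 t1; have l0 : 0 < l := lt_le_trans ltr01 l1.
have lt1 : 1 <= l * t by rewrite mulr_ege1.
have lV01 : (l `^ p^-1)^-1 \in `[0, 1].
  rewrite in_itv/= invr_ge0 powR_ge0/= invf_le1 ?powR_gt0//.
  by rewrite -(powRr0 l) ler_powR// invr_ge0 ltW.
rewrite -lef_pV2 ?posrE ?mulr_gt0 ?powR_gt0 ?fundamental_gt0//.
have phiV := fundamentalV_unit t1.
rewrite -orlicz_le_mono ?fundamentalV_unit//; last first.
  move: lV01 phiV; rewrite !in_itv/= => /andP[l'0 l'1] /andP[? ?].
  by rewrite invfM mulr_ge0//= mulr_ile1.
rewrite invfM (le_trans (orlicz_dilate lV01 phiV))//.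
rewrite !orlicz_fundamentalV// -powRN -powRrM mulNr mulVf ?gt_eqF//.
by rewrite powR_inv1 ?(ltW l0)// invfM.
Qed.

Lemma fundamental1 : phi 1 = 1.
Proof.
apply/eqP; rewrite -invr_eq1; apply/eqP; apply: orlicz_inj.
- exact: fundamentalV_unit.
- by rewrite in_itv/= lexx ler01.
- by rewrite orlicz_fundamentalV// invr1 orlicz1.
Qed.

End OrliczFunctions.

(** * The modular, the quasi-norm and coordinate counts *)

Section OrliczModular.
Context {R : realType} (p : R) (M : R -> R).
Hypotheses (p_gt0 : 0 < p) (M_orlicz : p_orlicz_function p M).

Lemma orlicz_ext_ge0 (t : R) : 0 <= t -> (0 <= orlicz_ext M t)%E.
Proof.
move=> t0; rewrite /orlicz_ext; case: ifP => // t1; rewrite lee_fin.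
have : M t \in `[0, 1] by apply: (orlicz_unit_itv p_gt0) => //; rewrite in_itv/= t0.
by rewrite in_itv => /andP[].
Qed.

Lemma orlicz_ext_le (s t : R) : 0 <= s -> s <= t ->
  (orlicz_ext M s <= orlicz_ext M t)%E.
Proof.
move=> s0 st; rewrite /orlicz_ext; case: (leP t 1) => t1; last by rewrite leey.
rewrite (le_trans st t1) lee_fin; apply: (orlicz_le p_gt0) => //.
  by rewrite in_itv/= s0 (le_trans st).
by rewrite in_itv/= t1 (le_trans s0).
Qed.

Lemma orlicz_ext_dilate (l t : R) : l \in `]0, 1] -> 0 <= t ->
  (orlicz_ext M (l * t) <= (l `^ p)%:E * orlicz_ext M t)%E.
Proof.
rewrite in_itv/= => /andP[l0 l1] t0; rewrite {2}/orlicz_ext.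
case: (leP t 1) => t1; last by rewrite gt0_muley ?leey// lte_fin powR_gt0.
rewrite /orlicz_ext (_ : l * t <= 1); last by rewrite mulr_ile1// ltW.
rewrite -EFinM lee_fin; apply: orlicz_dilate => //.
  by rewrite in_itv/= l1 ltW.
by rewrite in_itv/= t0.
Qed.

Let ext_norm_ge0 (x : nat -> R) (rho : R) (i : nat) : 0 < rho ->
  (0 <= orlicz_ext M (`|x i| / rho))%E.
Proof. by move=> r0; apply: orlicz_ext_ge0; rewrite divr_ge0// ltW. Qed.

Lemma orlicz_modular_le (x : nat -> R) (rho rho' : R) : 0 < rho -> rho <= rho' ->
  (orlicz_modular M x rho' <= orlicz_modular M x rho)%E.
Proof.
move=> r0 rr'; have r'0 := lt_le_trans r0 rr'.
apply: lee_nneseries => [i _ _|i _]; first exact: ext_norm_ge0.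
apply: orlicz_ext_le; first by rewrite divr_ge0// ltW.
by rewrite ler_wpM2l// lef_pV2.
Qed.

Lemma orlicz_modular_dilate (x : nat -> R) (l rho : R) : l \in `]0, 1] ->
  0 < rho ->
  (orlicz_modular M x (rho / l) <= (l `^ p)%:E * orlicz_modular M x rho)%E.
Proof.
move=> l01 r0; have := l01; rewrite in_itv/= => /andP[l0 l1].
rewrite /orlicz_modular -nneseriesZl; last by move=> i _; exact: ext_norm_ge0.
apply: lee_nneseries => [i _ _|i _]; first by apply: ext_norm_ge0; rewrite divr_gt0.
rewrite (_ : _ / _ = l * (`|x i| / rho)); last by rewrite invf_div; ring.
by apply: orlicz_ext_dilate => //; rewrite divr_ge0// ltW.
Qed.

Lemma orlicz_modular_le1_norm (x : nat -> R) (rho : R) : 0 < rho ->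
  (orlicz_modular M x rho <= 1)%E ->
  orlicz_space M x /\ orlicz_norm M x <= rho.
Proof.
move=> r0 x1; split; first by exists rho => //; apply: le_lt_trans x1 (ltry _).
by apply: ge_inf => //; exists 0 => y [/ltW].
Qed.

(** The strict inequality yields an admissible radius below [rho] without asking whether the infimum
    is attained. *)
Lemma orlicz_norm_lt_modular (x : nat -> R) (rho : R) : orlicz_space M x ->
  orlicz_norm M x < rho -> (orlicz_modular M x rho <= 1)%E.
Proof.
move=> [r r0 xr] xrho.
(* The infimum of an empty set would be the default 0, so an admissible radius must be exhibited. If
   the modular at [r] is [m], enlarging [r] by the factor [(1 + m) ^ (1/p)] lowers it to at most
   [m / (1 + m)]. *)
suff ne0 : [set rho | 0 < rho /\ (orlicz_modular M x rho <= 1)%E] !=set0.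
  have [r' [r'0 xr'] r'rho] := inf_lt ne0 xrho.
  by apply: le_trans xr'; apply: orlicz_modular_le => //; exact: ltW.
pose m := fine (orlicz_modular M x r).
have m0 : (0 <= orlicz_modular M x r)%E.
  by apply: nneseries_ge0 => i _ _; exact: ext_norm_ge0.
have mE : orlicz_modular M x r = m%:E by rewrite fineK// ge0_fin_numE.
have {}m0 : 0 <= m by rewrite -lee_fin -mE.
pose l := (1 + m)^-1 `^ p^-1.
have m1 : 0 < (1 + m)^-1 by rewrite invr_gt0 ltr_pwDl.
have l01 : l \in `]0, 1].
  rewrite in_itv/= powR_gt0//=.
  suff : l \in `[0, 1] by rewrite in_itv => /andP[].
  apply: powR_unit_itv; first by rewrite invr_ge0 ltW.
  by rewrite in_itv/= ltW//= invf_le1 ?ltr_pwDl// lerDl.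
exists (r / l); split.
  by rewrite divr_gt0//; move: l01; rewrite in_itv => /andP[].
apply: le_trans (orlicz_modular_dilate _ l01 r0) _.
rewrite mE -EFinM lee_fin powR_Kinv ?(ltW m1)// [leLHS]mulrC.
by rewrite ler_pdivrMr ?mul1r ?lerDr// ltr_pwDl.
Qed.

(** The coordinate bound excludes the value [+oo], so that only real partial sums remain to be
    estimated. *)
Lemma orlicz_modular_le_partial (x : nat -> R) (rho c : R) : 0 < rho ->
  (forall i, `|x i| <= rho) ->
  (forall n, \sum_(0 <= i < n) M (`|x i| / rho) <= c) ->
  (orlicz_modular M x rho <= c%:E)%E.
Proof.
move=> r0 xr part; apply: lime_le.
  by apply: is_cvg_nneseries => i _ _; exact: ext_norm_ge0.
apply: nearW => n; rewrite (eq_bigr (fun i => (M (`|x i| / rho))%:E)).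
  by rewrite sumEFin lee_fin.
by move=> i _; rewrite /orlicz_ext ler_pdivrMr// mul1r xr.
Qed.

Lemma orlicz_modular_partial_le (x : nat -> R) (rho c : R) : 0 < rho ->
  (orlicz_modular M x rho <= c%:E)%E ->
  (forall i, `|x i| <= rho) /\
  (forall n, \sum_(0 <= i < n) M (`|x i| / rho) <= c).
Proof.
move=> r0 xc; have xr i : `|x i| <= rho.
  rewrite leNgt; apply/negP => xi.
  have : orlicz_modular M x rho = +oo%E.
    apply: (@nneseries_pinfty _ _ _ i) => // [j _|]; first exact: ext_norm_ge0.
    by rewrite /orlicz_ext ler_pdivrMr// mul1r leNgt xi.
  by move=> xoo; move: xc; rewrite xoo.
split=> // n; rewrite -lee_fin -sumEFin; apply: le_trans xc.
rewrite (eq_bigr (fun i => orlicz_ext M (`|x i| / rho))).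
  by apply: nneseries_lim_ge => i _ _; exact: ext_norm_ge0.
by move=> i _; rewrite /orlicz_ext ler_pdivrMr// mul1r xr.
Qed.

(** Each of the at most [m] nonzero coordinates contributes at most [M (1 / phi m) = 1/m]. *)
Lemma orlicz_modular_finite_support (x : nat -> R) (m : nat) (s : seq nat) :
  (0 < m)%N -> (size s <= m)%N ->
  {in s, forall i, `|x i| <= (fundamental_function M m%:R)^-1} ->
  (forall i, i \notin s -> x i = 0) -> (orlicz_modular M x 1 <= 1)%E.
Proof.
move=> m0 sm xs xNs; have m1 : 1 <= m%:R :> R by rewrite ler1n.
have phiV := fundamentalV_unit p_gt0 M_orlicz m1.
have := phiV; rewrite in_itv/= => /andP[phi0 phi1].
apply: orlicz_modular_le_partial => // [i|n].
  have [/xs/le_trans|/xNs->] := boolP (i \in s); last by rewrite normr0.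
  exact.
apply: (@le_trans _ _ (\sum_(0 <= i < n) (i \in s)%:R / m%:R)).
  apply: ler_sum => i _; rewrite divr1; have [si|/xNs->] := boolP (i \in s).
    rewrite mul1r -(orlicz_fundamentalV p_gt0 M_orlicz m1).
    apply: (orlicz_le p_gt0) => //; last exact: xs.
    by rewrite in_itv/= normr_ge0 (le_trans (xs _ si)).
  by rewrite normr0 (orlicz0 p_gt0)// mul0r.
rewrite -mulr_suml ler_pdivrMr ?ltr0n// mul1r -natr_sum ler_nat.
apply: leq_trans sm; rewrite -big_mkcond /= sum1_count -size_filter.
apply: uniq_leq_size; first by rewrite filter_uniq// iota_uniq.
by move=> i; rewrite mem_filter => /andP[].
Qed.

(** Each coordinate in [s] contributes at least [orlicz_ext M u], which exceeds
    [M (1 / phi t) = 1/t], and the total is at most 1. If [u > 1], one such coordinate already makes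
    the modular infinite. *)
Lemma card_large_coordinates (x : nat -> R) (rho u t : R) (s : seq nat) :
  0 < rho -> (orlicz_modular M x rho <= 1)%E -> 1 <= t ->
  (fundamental_function M t)^-1 < u -> uniq s ->
  {in s, forall i, u <= `|x i| / rho} -> (size s)%:R < t.
Proof.
move=> r0 x1 t1 phiu us large; have t0 : 0 < t := lt_le_trans ltr01 t1.
have [/size0nil->//|s0] := posnP (size s).
have sum_le1 : (\sum_(i <- s) orlicz_ext M (`|x i| / rho) <= 1)%E.
  apply: le_trans x1.
  have [m sm] : exists m, {in s, forall i, (i < m)%N}.
    exists (\max_(i <- s) i).+1 => i si; rewrite ltnS.
    exact: (leq_bigmax_seq i).
  apply: le_trans (nneseries_lim_ge (m := 0) m _); last first.
    by move=> i _ _; exact: ext_norm_ge0.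
  rewrite (_ : (\sum_(i <- s) _)%E =
      (\sum_(0 <= i < m | i \in s) orlicz_ext M (`|x i| / rho))%E).
    by apply: (@lee_sum_nneg _ _ _ predT) => i _ _; exact: ext_norm_ge0.
  rewrite -[in RHS]big_filter; apply: perm_big; apply: uniq_perm => //.
    by rewrite filter_uniq// iota_uniq.
  move=> i; rewrite mem_filter mem_index_iota/=.
  by case: (boolP (i \in s)) => // /sm ->.
have ut : (t^-1%:E < orlicz_ext M u)%E.
  have phiV := fundamentalV_unit p_gt0 M_orlicz t1.
  rewrite /orlicz_ext; case: ifP => u1; last by rewrite ltry.
  rewrite lte_fin -(orlicz_fundamentalV p_gt0 M_orlicz t1).
  apply: (orlicz_lt p_gt0) => //.
  by move: phiV; rewrite !in_itv/= u1 => /andP[f0 _]; rewrite (le_trans f0)// ltW.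
have u0 : 0 <= u.
  by apply: le_trans (ltW phiu); rewrite invr_ge0 ltW// (fundamental_gt0 p_gt0).
have sizeE : ((size s)%:R%:E * orlicz_ext M u <= 1)%E.
  apply: le_trans sum_le1.
  rewrite (_ : (_ * _)%E = (\sum_(i <- s) orlicz_ext M u)%E).
    rewrite big_seq [leRHS]big_seq; apply: lee_sum => i si.
    by apply: orlicz_ext_le => //; exact: large.
  rewrite mule_natl big_const_seq count_predT.
  exact/esym/(iter_addr_0 (size s) (orlicz_ext M u)).
move: ut sizeE; rewrite /orlicz_ext; case: ifP => u1; last first.
  by rewrite gt0_muley ?lte_fin ?ltr0n.
rewrite lte_fin -EFinM lee_fin => ut sM.
rewrite -(@ltr_pM2r _ t^-1) ?invr_gt0// mulfV ?gt_eqF//.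
by apply: lt_le_trans sM; rewrite ltr_pM2l ?ltr0n.
Qed.

End OrliczModular.

(** * Counting words: exponential moments and Hamming balls *)

Section Counting.
Context {R : realType} (I J : finType).

(* Chernoff's bound for the uniform measure on words. *)
Lemma card_weight_le (w : I -> J -> R) (E : R) :
  #|[pred f : {ffun I -> J} | \sum_i w i (f i) <= E]|%:R <=
  expR E * \prod_i \sum_j expR (- w i j).
Proof.
rewrite bigA_distr_bigA mulr_sumr -sum1_card natr_sum.
rewrite [leRHS](bigID [pred f : {ffun I -> J} | \sum_i w i (f i) <= E])/=.
rewrite -[leLHS]addr0; apply: lerD; last first.
  apply: sumr_ge0 => f _; apply: mulr_ge0; first exact: expR_ge0.
  by apply: prodr_ge0 => i _; exact: expR_ge0.
rewrite (eq_bigl [pred f : {ffun I -> J} | \sum_i w i (f i) <= E]); last first.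
  by move=> f; rewrite !inE.
apply: ler_sum => f /= wf.
rewrite -expR_sum -expRD sumrN -[leLHS](@expR0 R) ler_expR.
by rewrite subr_ge0.
Qed.

(** The moment bound with weight [ln #|J|] for each disagreement with [g]: every coordinate then
    gives a factor [1 + (#|J| - 1) / #|J| <= 2]. *)
Lemma card_hamming_ball (g : {ffun I -> J}) (D : nat) : (0 < #|J|)%N ->
  (#|[pred f : {ffun I -> J} | (#|[pred i | f i != g i]| <= D)%N]| <=
    2 ^ #|I| * #|J| ^ D)%N.
Proof.
move=> J0; have J0R : (0 : R) < #|J|%:R by rewrite ltr0n.
pose w (i : I) (j : J) : R := ln (#|J|%:R) *+ (j != g i).
have wE (f : {ffun I -> J}) :
    \sum_i w i (f i) = ln #|J|%:R * #|[pred i | f i != g i]|%:R.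
  rewrite mulr_natr -sumr_const [in RHS]big_mkcond/=.
  by apply: eq_bigr => i _; rewrite /w inE; case: (f i != g i).
rewrite -(ler_nat R).
apply: (@le_trans _ _ (expR (ln #|J|%:R * D%:R) *
                       \prod_i \sum_j expR (- w i j))).
  apply: le_trans (card_weight_le _ _); rewrite ler_nat; apply: subset_leq_card.
  apply/fintype.subsetP => f; rewrite !inE => fD; rewrite wE.
  by rewrite ler_wpM2l ?ler_nat// ln_ge0// ler1n.
rewrite natrM mulrC expRM_natr lnK ?posrE// -natrX ler_wpM2r ?ler0n//.
rewrite natrX -prodr_const ler_prod// => i _.
rewrite sumr_ge0/=; last by move=> j _; exact: expR_ge0.
rewrite (bigD1 (g i))//= {1}/w eqxx/= mulr0n oppr0 expR0 [leRHS](_ : 2 = 1 + 1)//.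
rewrite lerD2l.
apply: (@le_trans _ _ (\sum_(j : J) #|J|%:R^-1)); last first.
  by rewrite sumr_const -[leLHS]mulr_natr mulVf// gt_eqF.
rewrite [leRHS](bigD1 (g i))//= -[leLHS]add0r lerD ?invr_ge0 ?ler0n//.
by apply: ler_sum => j gj; rewrite /w gj/= mulr1n expRN lnK.
Qed.

(** Each nonempty fibre of [h] lies in the Hamming ball of radius [D] around any of its members. *)
Lemma packing_bound (N D : nat) (h : {ffun I -> J} -> 'I_N) : (0 < #|J|)%N ->
  (forall f g, h f = h g -> (#|[pred i | f i != g i]| <= D)%N) ->
  (#|J| ^ #|I| <= N * (2 ^ #|I| * #|J| ^ D))%N.
Proof.
move=> J0 hD; rewrite -card_ffun -sum1_card.
rewrite (partition_big h predT)//= -[X in (_ <= X * _)%N](card_ord N) -sum_nat_const.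
apply: leq_sum => n _; rewrite sum1_card.
have [g /eqP hg|h0] := pickP [pred g | h g == n]; last first.
  by rewrite (eq_card0 (A := _)).
apply: leq_trans (card_hamming_ball g D J0); apply: subset_leq_card.
by apply/fintype.subsetP => f; rewrite !inE => hf; apply: hD; rewrite hg; apply/eqP.
Qed.

End Counting.

(** * Lower bounds for entropy numbers by separated words *)

Section LowerBound.
Context {R : realType} (p : R) (M1 M2 : R -> R) (alpha : nat -> R).
Hypothesis p_gt0 : 0 < p.
Hypotheses (M1_orlicz : p_orlicz_function p M1).
Hypotheses (M2_orlicz : p_orlicz_function p M2).

Local Notation phi1 := (fundamental_function M1).
Local Notation phi2 := (fundamental_function M2).

(** Here [pos f j] is the coordinate at which the j-th letter of [f] is read. If the images of [f]
    and [g] share a centre, they differ by [eps * (b - b')] with [b], [b'] in the unit ball;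
    wherever the letters differ, [b] or [b'] has size at least [delta / eps]. Each does so at fewer
    than [t] coordinates, hence the Hamming distance is at most [D]. *)
Lemma entropy_ge_packing (k m q D : nat) (delta t : R)
    (x : {ffun 'I_m -> 'I_q} -> nat -> R)
    (pos : {ffun 'I_m -> 'I_q} -> 'I_m -> nat) :
  (0 < q)%N -> 1 <= t ->
  (forall f, (orlicz_modular M1 (x f) 1 <= 1)%E) ->
  (forall f, injective (pos f)) ->
  (forall (f g : {ffun 'I_m -> 'I_q}) j, f j != g j ->
    2 * delta <= `|alpha (pos f j).+1 * (x f (pos f j) - x g (pos f j))|) ->
  (forall a b : nat, a%:R < t -> b%:R < t -> (a + b <= D)%N) ->
  (2 ^ k.-1 * (2 ^ m * q ^ D) < q ^ m)%N ->
  ((delta * phi2 t)%:E <= diagonal_entropy_number M1 M2 alpha k)%E.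
Proof.
move=> q0 t1 x1 posI sep abD; rewrite ltnNge => /negP cnt.
apply: le_ereal_inf_tmp => _ [eps [eps0 [y [Yy cover]]] <-].
rewrite lee_fin leNgt; apply/negP => epslt; apply: cnt.
have phi0 : 0 < phi2 t by exact: (fundamental_gt0 p_gt0).
have delta0 : 0 < delta.
  by rewrite -(pmulr_lgt0 _ phi0); exact: lt_trans epslt.
have /choice[h hP] f : exists i : 'I_(2 ^ k.-1), exists b,
    unit_ball (orlicz_space M2) (orlicz_norm M2) b /\
    diagonal_operator alpha (x f) = y i + eps *: b.
  have [|i _ [b bB bE]] := cover (diagonal_operator alpha (x f)).
    exists (x f) => //; exact: (orlicz_modular_le1_norm (M := M1)).
  by exists i, b.
rewrite -(card_ord (2 ^ k.-1)).
have := @packing_bound R 'I_m 'I_q _ D h; rewrite !card_ord; apply=> // f g hfg.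
have [b [[b2 b1] bE]] := hP f; have [b' [[b'2 b'1] b'E]] := hP g.
pose u' := delta / eps.
have phiu' : (phi2 t)^-1 < u'.
  rewrite /u' -(@ltr_pM2l _ (phi2 t))// mulfV ?gt_eqF// mulrA ltr_pdivlMr//.
  by rewrite mul1r mulrC.
(* A norm at most 1 controls the modular only at radii above 1. A threshold strictly between
   [1 / phi2 t] and [u'] leaves room for the radius [u' / u > 1]. *)
pose u := ((phi2 t)^-1 + u') / 2.
have phiu : (phi2 t)^-1 < u by rewrite /u; lra.
have uu' : u < u' by rewrite /u; lra.
have u0 : 0 < u by apply: lt_trans phiu; rewrite invr_gt0.
have rho1 : 1 < u' / u by rewrite ltr_pdivlMr// mul1r.
have rho0 : 0 < u' / u by exact: lt_trans rho1.
have small c : orlicz_space M2 c -> orlicz_norm M2 c <= 1 ->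
    #|[pred j | (f j != g j) && (u' <= `|c (pos f j)|)]|%:R < t.
  move=> c2 c1; rewrite cardE -(size_map (pos f)).
  have cm : (orlicz_modular M2 c (u' / u) <= 1)%E.
    exact: (orlicz_norm_lt_modular p_gt0 M2_orlicz c2 (le_lt_trans c1 rho1)).
  apply: (card_large_coordinates p_gt0 M2_orlicz rho0 cm t1 phiu).
    by rewrite map_inj_uniq ?enum_uniq.
  move=> i /mapP[j]; rewrite mem_enum inE => /andP[_ cj] ->.
  by rewrite invf_div mulrA ler_pdivlMr ?(lt_trans u0)// mulrC ler_pM2r.
apply: leq_trans (abD _ _ (small b b2 b1) (small b' b'2 b'1)).
rewrite -cardUI; apply: leq_trans (leq_addr _ _).
apply: subset_leq_card; apply/fintype.subsetP => j; rewrite !inE => fgj.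
rewrite fgj/= -implyNb -ltNge; apply/implyP => bsmall; rewrite leNgt.
apply/negP => b'small; have := sep f g j fgj.
have -> : alpha (pos f j).+1 * (x f (pos f j) - x g (pos f j)) =
    eps * (b (pos f j) - b' (pos f j)).
  have := congr1 (fun z => z (pos f j)) bE.
  have := congr1 (fun z => z (pos f j)) b'E.
  rewrite /diagonal_operator /= -hfg => e1 e2.
  rewrite mulrBr e1 e2 !fctE /=.
  by rewrite mulrBr /GRing.scale/=; ring.
apply/negP; rewrite -ltNge normrM gtr0_norm//.
apply: (@lt_le_trans _ _ (eps * (u' + u'))).
  by rewrite ltr_pM2l// (le_lt_trans (ler_normB _ _))// ltrD.
rewrite (_ : eps * _ = 2 * delta)// /u'; field; exact: lt0r_neq0.
Qed.

Hypothesis alpha_ge0 : forall i : nat, (1 <= i)%N -> 0 <= alpha i.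
Hypothesis alpha_noninc : forall i j : nat,
  (1 <= i)%N -> (i <= j)%N -> alpha j <= alpha i.

(** The first [k] coordinates take the values [j / (16 phi1 k)] with [j < 16]. Distinct letters are
    at least [1 / (16 phi1 k)] apart, whence the 32. Two counts below [max 1 (k/4)] add up to at
    most [k./2], and in powers of 2 the count reads [(k - 1) + k + 4 (k./2) < 4 k]. *)
Lemma entropy_ge_first_term (k : nat) : (1 <= k)%N ->
  ((alpha k / (32 * phi1 k%:R) * phi2 (Num.max 1 (k%:R / 4)))%:E <=
    diagonal_entropy_number M1 M2 alpha k)%E.
Proof.
move=> k1; have k1R : 1 <= k%:R :> R by rewrite ler1n.
have phi0 : 0 < phi1 k%:R by exact: (fundamental_gt0 p_gt0).
have phiV0 : 0 < (phi1 k%:R)^-1 by rewrite invr_gt0.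
pose x (f : {ffun 'I_k -> 'I_16}) (i : nat) : R :=
  if insub i is Some j then (f j : nat)%:R / 16 / phi1 k%:R else 0.
have xE f (j : 'I_k) : x f j = (f j : nat)%:R / 16 / phi1 k%:R.
  by rewrite /x valK.
apply: (@entropy_ge_packing k k 16 k./2 _ _ x (fun _ j => j)) => //.
- by rewrite le_max lexx.
- move=> f; apply: (orlicz_modular_finite_support p_gt0 M1_orlicz (s := iota 0 k) k1).
  + by rewrite size_iota.
  + move=> i; rewrite mem_iota/= add0n => ik.
    rewrite (xE f (Ordinal ik)) ger0_norm ?divr_ge0 ?(ltW phi0)//.
    rewrite -[leRHS]mul1r ler_pM2r//.
    suff : (f (Ordinal ik) : nat)%:R <= 16 :> R by lra.
    by rewrite ler_nat ltnW.
  + by move=> i; rewrite mem_iota/= add0n => ik; rewrite /x insubN.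
- by move=> f; exact: val_inj.
- move=> f g j fgj; rewrite !xE -!mulrBl !normrM (gtr0_norm phiV0).
  rewrite (ger0_norm (alpha_ge0 _))// (@gtr0_norm _ 16^-1) ?invr_gt0//.
  have -> : 2 * (alpha k / (32 * phi1 k%:R)) = alpha k * (1 / 16 / phi1 k%:R).
    by field; exact: lt0r_neq0.
  rewrite ler_pM ?alpha_ge0 ?alpha_noninc// ?divr_ge0 ?(ltW phi0)//.
  rewrite ler_pM2r// ler_pM2r ?invr_gt0//.
  have fgj' : (f j : nat) != g j by [].
  case: (ltngtP (f j) (g j)) fgj' => // fg _.
  + rewrite distrC ger0_norm ?subr_ge0 ?ler_nat ?(ltnW fg)//.
    by rewrite -natrB ?(ltnW fg)// ler1n subn_gt0.
  + rewrite ger0_norm ?subr_ge0 ?ler_nat ?(ltnW fg)//.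
    by rewrite -natrB ?(ltnW fg)// ler1n subn_gt0.
- move=> a b; rewrite !lt_max => /orP[a1|a4] /orP[b1|b4].
  + by move: a1 b1; rewrite !ltrn1; lia.
  + move: a1; rewrite ltrn1.
    have : (b * 4 < k)%N by rewrite -(ltr_nat R) natrM -ltr_pdivlMr.
    by lia.
  + move: b1; rewrite ltrn1.
    have : (a * 4 < k)%N by rewrite -(ltr_nat R) natrM -ltr_pdivlMr.
    by lia.
  + have : (b * 4 < k)%N by rewrite -(ltr_nat R) natrM -ltr_pdivlMr.
    have : (a * 4 < k)%N by rewrite -(ltr_nat R) natrM -ltr_pdivlMr.
    by lia.
- rewrite -[16%N]/(2 ^ 4)%N -!expnM -!expnD ltn_exp2l//.
  by have := odd_double_half k; lia.
Qed.

Lemma entropy_ge_sparse_term (k s : nat) : (8 <= s <= k)%N ->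
  ((alpha (k * 2 ^ s.-1)%N / (2 * 8 `^ p^-1 * phi1 (k%:R / s%:R)) *
    phi2 (k%:R / s%:R))%:E <= diagonal_entropy_number M1 M2 alpha k)%E.
Proof.
move=> /andP[s8 sk]; have s0 : (0 < s)%N by exact: leq_trans s8.
have s0R : (0 : R) < s%:R by rewrite ltr0n.
have ks1 : 1 <= k%:R / s%:R :> R by rewrite ler_pdivlMr// mul1r ler_nat.
(* [c] is the ceiling of [k / s]. From [c s < k + s <= 2 k] and [8 <= s] follow [m <= k], which
   keeps all positions below [k q], and [m <= 8 k / s], the source of the constant [8 ^ (1/p)]. *)
pose c := (k.-1 %/ s).+1; pose m := (4 * c)%N; pose q := (2 ^ s.-1)%N.
have q0 : (0 < q)%N by rewrite expn_gt0.
have kE := divn_eq k.-1 s.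
have ks := ltn_pmod k.-1 s0.
have kcs : (k <= c * s)%N by rewrite /c mulSn; lia.
have csk : (c * s < k + s)%N by rewrite /c mulSn; lia.
have mk : (m <= k)%N by rewrite /m; nia.
have c1R : 1 <= c%:R :> R by rewrite ler1n.
have m1R : 1 <= m%:R :> R by rewrite ler1n.
have phi0 : 0 < phi1 m%:R by exact: (fundamental_gt0 p_gt0).
have phiV0 : 0 < (phi1 m%:R)^-1 by rewrite invr_gt0.
pose x (f : {ffun 'I_m -> 'I_q}) (i : nat) : R :=
  if insub (i %/ q)%N is Some j then
    if (f j : nat) == (i %% q)%N then (phi1 m%:R)^-1 else 0 else 0.
pose pos (f : {ffun 'I_m -> 'I_q}) (j : 'I_m) := (j * q + f j)%N.
have posq f j : (pos f j %/ q)%N = j.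
  by rewrite /pos divnMDl// divn_small ?addn0.
have posr f j : (pos f j %% q)%N = f j by rewrite /pos modnMDl modn_small.
have xpos f g j : x g (pos f j) = if g j == f j then (phi1 m%:R)^-1 else 0.
  by rewrite /x posq valK posr.
have main : ((alpha (k * q)%N / (2 * phi1 m%:R) * phi2 c%:R)%:E <=
    diagonal_entropy_number M1 M2 alpha k)%E.
  apply: (@entropy_ge_packing k m q (2 * c.-1) _ _ x pos) => //.
  - move=> f; apply: (orlicz_modular_finite_support p_gt0 M1_orlicz
      (m := m) (s := map (pos f) (enum 'I_m))) => //.
    + by rewrite size_map size_enum_ord.
    + move=> _ /mapP[j _ ->]; rewrite xpos eqxx ger0_norm//.
      exact: ltW.
    + move=> i; rewrite /x; case: insubP => // j _ ji.
      case: eqP => // fj /mapP[]; exists j; first by rewrite mem_enum.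
      by rewrite /pos ji fj -divn_eq.
  - by move=> f j j' /(congr1 (fun n => n %/ q)%N); rewrite !posq => /val_inj.
  - move=> f g j; rewrite eq_sym => /negbTE fgj; rewrite !xpos eqxx fgj subr0.
    have -> : 2 * (alpha (k * q)%N / (2 * phi1 m%:R)) =
        alpha (k * q)%N * (phi1 m%:R)^-1 by field; exact: lt0r_neq0.
    rewrite normrM (gtr0_norm phiV0) ger0_norm ?alpha_ge0//.
    rewrite ler_pM2r// alpha_noninc//.
    apply: (@leq_trans (m * q)); last by rewrite leq_mul2r mk orbT.
    rewrite /pos -addnS; apply: (@leq_trans (j * q + q)); first by rewrite leq_add2l.
    by rewrite -mulSnr leq_mul2r ltn_ord orbT.
  - by move=> a b; rewrite !ltr_nat; lia.
  (* In exponents of 2: [(k - 1) + 4 c + 2 (s - 1) (c - 1) < 4 c (s - 1)], which follows from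
     [k <= c s] and [8 <= s]. *)
  - by rewrite /q -!expnM -!expnD ltn_exp2l// /m; nia.
apply: le_trans main; rewrite lee_fin.
have ksc : k%:R / s%:R <= c%:R :> R.
  by rewrite ler_pdivrMr// -natrM ler_nat.
have mks : m%:R <= 8 * (k%:R / s%:R) :> R.
  by rewrite mulrA ler_pdivlMr// -!natrM ler_nat /m; nia.
have phi1ks : 0 < phi1 (k%:R / s%:R) by exact: (fundamental_gt0 p_gt0).
have alphakq : 0 <= alpha (k * q)%N by rewrite alpha_ge0// muln_gt0 q0; lia.
apply: ler_pM.
- by rewrite mulr_ge0// invr_ge0 !mulr_ge0 ?powR_ge0 ?(ltW phi1ks).
- by rewrite ltW// (fundamental_gt0 p_gt0).
- rewrite ler_wpM2l// lef_pV2 ?posrE ?mulr_gt0 ?powR_gt0// -mulrA ler_pM2l//.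
  have h8 : 1 <= 8 :> R by rewrite ler1n.
  apply: le_trans (fundamental_dilate p_gt0 M1_orlicz h8 ks1).
  apply: (fundamental_le p_gt0 M1_orlicz); rewrite ?in_itv/= ?andbT//.
  by rewrite mulr_ege1.
- by apply: (fundamental_le p_gt0 M2_orlicz); rewrite ?in_itv/= ?andbT.
Qed.

End LowerBound.

(** * Powers of [2 ^ (1/p)] and the constant [c1] *)

Section PowersOfTwo.
Context {R : realType} (p : R).
Hypotheses (p_gt0 : 0 < p) (p_le1 : p <= 1).

Lemma powR_natM (a : R) (n : nat) : 0 <= a -> a `^ (n%:R / p) = (a `^ p^-1) ^+ n.
Proof. by move=> a0; rewrite mulrC powRrM powR_mulrn ?powR_ge0. Qed.

Lemma powR_exp (a : R) (n : nat) : 0 <= a -> (a ^+ n) `^ p^-1 = (a `^ p^-1) ^+ n.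
Proof. by move=> a0; rewrite -powR_mulrn// -powRrM powR_natM. Qed.

Lemma powR2V_ge2 : 2 <= 2 `^ p^-1 :> R.
Proof. by rewrite le1r_powR// ?ler1n// -invr1 lef_pV2 ?posrE. Qed.

Lemma log2_ge1 (x : R) : 2 <= x -> 1 <= log2 x.
Proof.
move=> x2; rewrite /log2 ler_pdivlMr ?ln_gt0 ?ltr1n// mul1r ler_ln ?posrE//.
exact: lt_le_trans x2.
Qed.

(** The rational, logarithmic and [(1/p) ^ (-1/p)] factors of [c1] are at most 1, and
    [2 ^ (-21/p) <= 2 ^ (-10/p)]. *)
Lemma c1_le : c1 p <= (2 `^ p^-1) ^- 10.
Proof.
have z2 := powR2V_ge2; have z0 : 0 < 2 `^ p^-1 :> R by rewrite powR_gt0.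
have le1 (a r : R) : 1 <= a -> 0 <= r -> a `^ (- r) <= 1.
  by move=> a1 r0; rewrite -(powRr0 a) ler_powR// oppr_le0.
have pV1 : 1 <= p^-1 by rewrite -invr1 lef_pV2 ?posrE.
rewrite /c1 -[leRHS]mulr1 ler_pM ?mulr_ge0 ?invr_ge0 ?exprn_ge0 ?powR_ge0//; last first.
  by rewrite le1// (le_trans ler01).
rewrite -[leRHS]mulr1 ler_pM ?mulr_ge0 ?invr_ge0 ?exprn_ge0 ?powR_ge0//; last first.
  have p24 : 2 <= 24 / p.
    by rewrite ler_pdivlMr//; apply: (@le_trans _ _ 2); rewrite ?ler_nat// ler_piMr.
  by rewrite le1 ?divr_ge0 ?(ltW p_gt0)// log2_ge1.
rewrite powRN powR_natM// -[leRHS]mul1r ler_pM ?invr_ge0 ?exprn_ge0 ?powR_ge0//.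
  by rewrite invf_le1 ?exprn_gt0// exprn_ege1// ler1n.
by rewrite lef_pV2 ?posrE ?exprn_gt0// ler_weXn2l// (le_trans _ z2)// ler1n.
Qed.

End PowersOfTwo.

(** * The terms of the maximum [Lambda] *)

Section LambdaTerms.
Context {R : realType} (M1 M2 : R -> R) (alpha : nat -> R).

Definition Lambda_term (k s : nat) : R := alpha (k * 2 ^ s.-1)%N *
  (fundamental_function M2 (k%:R / s%:R) / fundamental_function M1 (k%:R / s%:R)).

Lemma Lambda_ind (P : R -> Prop) (k : nat) : (1 <= k)%N ->
  (forall s, (1 <= s <= k)%N -> P (Lambda_term k s)) -> P (Lambda M1 M2 alpha k).
Proof.
move=> k1 PF; rewrite /Lambda big_nat; apply: big_ind.
- by apply: PF; rewrite k1.
- by move=> x y Px Py; case: leP.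
- by move=> s sk; apply: PF.
Qed.

Lemma Lambda_ge_term (k s : nat) : (1 <= s <= k)%N ->
  Lambda_term k s <= Lambda M1 M2 alpha k.
Proof.
move=> sk; apply: (@Order.TotalTheory.bigmax_sup_seq _ _ _ _ _ s) => //.
by rewrite mem_index_iota.
Qed.

End LambdaTerms.

(** * The lower estimate by [Lambda] *)

Section EntropyLowerBound.
Context {R : realType} (p : R) (M1 M2 : R -> R) (alpha : nat -> R).
Hypotheses (p_gt0 : 0 < p) (p_le1 : p <= 1).
Hypotheses (M1_orlicz : p_orlicz_function p M1).
Hypotheses (M2_orlicz : p_orlicz_function p M2).
Hypothesis alpha_ge0 : forall i : nat, (1 <= i)%N -> 0 <= alpha i.
Hypothesis alpha_noninc : forall i j : nat,
  (1 <= i)%N -> (i <= j)%N -> alpha j <= alpha i.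

Local Notation phi1 := (fundamental_function M1).
Local Notation phi2 := (fundamental_function M2).

(** For [s < 8] the term is compared with the one for [s = 1]: replacing [k/s] by [k] in [phi1]
    costs [8 ^ (1/p)], replacing [k] by [max 1 (k/4)] in [phi2] costs [4 ^ (1/p)]. With
    [z = 2 ^ (1/p) >= 2] the total loss is [32 z ^ 5 <= z ^ 10]. *)
Lemma entropy_ge_term (k s : nat) : (1 <= s <= k)%N ->
  (((2 `^ p^-1) ^- 10 * Lambda_term M1 M2 alpha k s)%:E <=
    diagonal_entropy_number M1 M2 alpha k)%E.
Proof.
move=> /andP[s1 sk]; have k1 := leq_trans s1 sk.
have z2 := powR2V_ge2 p_gt0 p_le1; set z := 2 `^ p^-1 in z2 *.
have z0 : 0 < z by rewrite powR_gt0.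
have s0R : (0 : R) < s%:R by rewrite ltr0n.
have k1R : 1 <= k%:R :> R by rewrite ler1n.
have ks1 : 1 <= k%:R / s%:R :> R by rewrite ler_pdivlMr// mul1r ler_nat.
have f1 : 0 < phi1 (k%:R / s%:R) by exact: (fundamental_gt0 p_gt0).
have f2 : 0 < phi2 (k%:R / s%:R) by exact: (fundamental_gt0 p_gt0).
have zE8 : 8 `^ p^-1 = z ^+ 3 by rewrite -powR_exp//; congr (_ `^ _); ring.
have zE4 : 4 `^ p^-1 = z ^+ 2 by rewrite -powR_exp//; congr (_ `^ _); ring.
have a0 : 0 <= alpha (k * 2 ^ s.-1)%N by rewrite alpha_ge0// muln_gt0 k1 expn_gt0.
have [s8|s8] := leqP 8 s.
  have s8k : (8 <= s <= k)%N by rewrite s8.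
  apply: le_trans
    (entropy_ge_sparse_term p_gt0 M1_orlicz M2_orlicz alpha_ge0 alpha_noninc s8k).
  rewrite lee_fin /Lambda_term zE8.
  have -> : alpha (k * 2 ^ s.-1)%N / (2 * z ^+ 3 * phi1 (k%:R / s%:R)) *
      phi2 (k%:R / s%:R) = (2 * z ^+ 3)^-1 *
      (alpha (k * 2 ^ s.-1)%N * (phi2 (k%:R / s%:R) / phi1 (k%:R / s%:R))).
    by field; rewrite !lt0r_neq0.
  apply: ler_wpM2r; first exact: mulr_ge0 a0 (ltW (divr_gt0 f2 f1)).
  rewrite lef_pV2 ?posrE ?mulr_gt0 ?exprn_gt0//.
  apply: (@le_trans _ _ (z ^+ 4)).
    by rewrite [leRHS]exprS ler_wpM2r// exprn_ge0// ltW.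
  by rewrite ler_weXn2l// (le_trans _ z2)// ler1n.
apply: le_trans
  (entropy_ge_first_term p_gt0 M1_orlicz M2_orlicz alpha_ge0 alpha_noninc k1).
have t1 : 1 <= Num.max 1 (k%:R / 4) :> R by rewrite le_max lexx.
set t := Num.max 1 _ in t1 *.
have t0 : 0 < t := lt_le_trans ltr01 t1.
have kt1 : 1 <= k%:R / t.
  rewrite ler_pdivlMr// mul1r ge_max k1R/=.
  by rewrite ler_pdivrMr// ler_peMr ?ler1n.
have kt4 : k%:R / t <= 4.
  rewrite ler_pdivrMr// mulrC -ler_pdivrMr//.
  by rewrite le_max lexx orbT.
have phi2k : phi2 k%:R <= z ^+ 2 * phi2 t.
  have := fundamental_dilate p_gt0 M2_orlicz kt1 t1.
  rewrite divfK ?gt_eqF// => /le_trans; apply.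
  rewrite ler_wpM2r ?(ltW (fundamental_gt0 p_gt0 M2_orlicz t1))// -zE4.
  by rewrite ge0_ler_powR ?nnegrE ?invr_ge0 ?(ltW p_gt0)// ?(le_trans ler01 kt1).
have s1R : 1 <= s%:R :> R by rewrite ler1n.
have phi1k : phi1 k%:R <= z ^+ 3 * phi1 (k%:R / s%:R).
  have := fundamental_dilate p_gt0 M1_orlicz s1R ks1.
  rewrite mulrC divfK ?gt_eqF// => /le_trans; apply.
  rewrite ler_wpM2r ?(ltW f1)// -zE8.
  rewrite ge0_ler_powR ?nnegrE ?invr_ge0 ?(ltW p_gt0)//.
  by rewrite ler_nat ltnW.
have phi2ks : phi2 (k%:R / s%:R) <= phi2 k%:R.
  apply: (fundamental_le p_gt0 M2_orlicz); rewrite ?in_itv/= ?andbT//.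
  by rewrite ler_pdivrMr// ler_peMr// (le_trans ler01).
have f1k : 0 < phi1 k%:R by exact: (fundamental_gt0 p_gt0).
have f2t : 0 < phi2 t by exact: (fundamental_gt0 p_gt0).
rewrite lee_fin /Lambda_term.
have ak : alpha (k * 2 ^ s.-1)%N <= alpha k.
  by apply: alpha_noninc => //; rewrite leq_pmulr// expn_gt0.
have ratio : phi2 (k%:R / s%:R) / phi1 (k%:R / s%:R) <=
    z ^+ 5 * (phi2 t / phi1 k%:R).
  rewrite ler_pdivrMr// (le_trans phi2ks)// (le_trans phi2k)//.
  have -> : z ^+ 5 * (phi2 t / phi1 k%:R) * phi1 (k%:R / s%:R) =
    (z ^+ 2 * phi2 t) * ((z ^+ 3 * phi1 (k%:R / s%:R)) / phi1 k%:R).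
    by field; rewrite lt0r_neq0.
  by rewrite ler_peMr ?mulr_ge0 ?exprn_ge0 ?(ltW z0) ?(ltW f2t)// ler_pdivlMr// mul1r.
apply: (@le_trans _ _ (z ^- 10 * (alpha k * (z ^+ 5 * (phi2 t / phi1 k%:R))))).
  rewrite ler_wpM2l ?invr_ge0 ?exprn_ge0 ?(ltW z0)//.
  by rewrite ler_pM// divr_ge0// ltW.
have -> : z ^- 10 * (alpha k * (z ^+ 5 * (phi2 t / phi1 k%:R))) =
    z ^- 5 * (alpha k * (phi2 t / phi1 k%:R)).
  by field; rewrite !lt0r_neq0.
have -> : alpha k / (32 * phi1 k%:R) * phi2 t =
    32^-1 * (alpha k * (phi2 t / phi1 k%:R)).
  by field; rewrite lt0r_neq0.
apply: ler_wpM2r; first exact: mulr_ge0 (alpha_ge0 k1) (ltW (divr_gt0 f2t f1k)).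
rewrite lef_pV2 ?posrE ?exprn_gt0// (_ : 32 = 2 ^+ 5); last by ring.
by rewrite lerXn2r ?nnegrE// ltW.
Qed.

Lemma entropy_ge_Lambda (k : nat) : (1 <= k)%N ->
  ((c1 p * Lambda M1 M2 alpha k)%:E <= diagonal_entropy_number M1 M2 alpha k)%E.
Proof.
move=> k1; pose P x := ((c1 p * x)%:E <= diagonal_entropy_number M1 M2 alpha k)%E.
apply: (Lambda_ind (P := P) k1) => s sk; rewrite /P.
apply: le_trans (entropy_ge_term sk); rewrite lee_fin ler_wpM2r ?c1_le//.
case/andP: sk => s1 sk.
have ks1 : 1 <= k%:R / s%:R :> R by rewrite ler_pdivlMr ?ltr0n// mul1r ler_nat.
have f1 : 0 < phi1 (k%:R / s%:R) by exact: (fundamental_gt0 p_gt0).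
have f2 : 0 < phi2 (k%:R / s%:R) by exact: (fundamental_gt0 p_gt0).
apply: mulr_ge0 (ltW (divr_gt0 f2 f1)).
by rewrite alpha_ge0// muln_gt0 k1 expn_gt0.
Qed.

End EntropyLowerBound.

(** * Elementary sums and stretched exponentials *)

Section Sums.
Context {R : realType}.

(** Telescoping, since [1 / (i+1)^2 <= 1/i - 1/(i+1)]. *)
Lemma sum_inv_sqr (k n : nat) : (0 < k)%N -> (k <= n)%N ->
  \sum_(k <= i < n) (i.+1%:R ^+ 2)^-1 <= k%:R^-1 - n%:R^-1 :> R.
Proof.
move=> k0 kn; rewrite -(subnK kn) addnC; elim: (n - k)%N => [|m IH].
  by rewrite addn0 big_geq// subrr.
rewrite addnS big_nat_recr ?leq_addr//=.
have -> : k%:R^-1 - (k + m).+1%:R^-1 =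
    k%:R^-1 - (k + m)%:R^-1 + ((k + m)%:R^-1 - (k + m).+1%:R^-1) :> R by ring.
apply: lerD => //.
have km0 : 0 < (k + m)%:R :> R by rewrite ltr0n addn_gt0 k0.
rewrite -natr1; move: (k + m)%:R km0 => x km0.
have x0 : 0 < x + 1 by exact: addr_gt0.
have -> : x^-1 - (x + 1)^-1 = (x * (x + 1))^-1.
  by field; rewrite !lt0r_neq0.
by rewrite lef_pV2 ?posrE ?exprn_gt0 ?mulr_gt0// expr2 ler_pM2r// lerDl.
Qed.

Lemma sum_inv_sqrt (n : nat) :
  \sum_(0 <= i < n) (Num.sqrt i.+1%:R)^-1 <= 2 * Num.sqrt n%:R :> R.
Proof.
elim: n => [|n IH]; first by rewrite big_geq// sqrtr0 mulr0.
rewrite big_nat_recr//=.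
set a := Num.sqrt n%:R : R in IH *; set b := Num.sqrt n.+1%:R : R.
have b0 : 0 < b by rewrite sqrtr_gt0 ltr0n.
have a0 : 0 <= a by rewrite sqrtr_ge0.
have ab : a <= b by rewrite ler_wsqrtr// ler_nat.
have e : b ^+ 2 - a ^+ 2 = 1.
  by rewrite !sqr_sqrtr// -natr1; ring.
apply: (@le_trans _ _ (2 * a + b^-1)); first by rewrite lerD2r.
suff : b^-1 <= 2 * (b - a) by lra.
rewrite -(@ler_pM2r _ b)// mulVf ?gt_eqF//.
(* As [(b - a) (b + a) = 1] and [a <= b], one has [1 <= 2 b (b - a)]. *)
by nra.
Qed.

Lemma sum_divn (h : nat -> R) (Q N : nat) : (0 < N)%N ->
  \sum_(0 <= c < Q * N) h (c %/ N)%N = N%:R * \sum_(0 <= d < Q) h d.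
Proof.
move=> N0; elim: Q => [|Q IH]; first by rewrite mul0n !big_geq// mulr0.
rewrite big_nat_recr//= mulrDr -IH mulSnr (@big_cat_nat _ _ _ (Q * N)%N)//= ?leq_addr//.
congr (_ + _); rewrite -{1}[(Q * N)%N]add0n big_addn addKn.
rewrite (@eq_big_nat _ _ _ _ _ _ (fun=> h Q)).
  by rewrite big_const_nat iter_addr_0 subn0 mulr_natl.
by move=> c /andP[_ cN]; rewrite addnC divnMDl// divn_small ?addn0.
Qed.

Lemma expR1_ge2 : 2 <= expR 1 :> R.
Proof. by have := expR_ge1Dx (1 : R); lra. Qed.

Lemma expRN_le (n : nat) : expR (- n%:R) <= 2 ^- n :> R.
Proof.
rewrite expRN lef_pV2 ?posrE ?expR_gt0 ?exprn_gt0//.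
by rewrite -[n%:R]mulr1 expRM_natl lerXn2r ?nnegrE ?expR_ge0// expR1_ge2.
Qed.

(* The bound c^p >= 1 + p ln c turns the stretched exponential into a power. *)
Lemma expR_powR_le (p s : R) (c : nat) : 0 < p -> 1 <= s -> (0 < c)%N ->
  expR (- (8 / p * s * c%:R `^ p)) <= expR (- (8 / p * s)) * (c%:R ^+ 2)^-1.
Proof.
move=> p0 s1 c0; have c0R : 0 < c%:R :> R by rewrite ltr0n.
have lnc : 0 <= ln c%:R :> R by rewrite ln_ge0// ler1n.
rewrite -[X in _ <= _ * X^-1]lnK ?posrE ?exprn_gt0// -expRN -expRD ler_expR.
rewrite lnXn// -opprD lerN2.
have cp : 1 + p * ln c%:R <= c%:R `^ p.
  by rewrite /powR gt_eqF// expR_ge1Dx.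
apply: (@le_trans _ _ (8 / p * s * (1 + p * ln c%:R))); last first.
  by rewrite ler_wpM2l// mulr_ge0 ?divr_ge0 ?ltW// (lt_le_trans ltr01).
have -> : 8 / p * s * (1 + p * ln c%:R) = 8 / p * s + 8 * s * ln c%:R.
  by field; rewrite lt0r_neq0.
rewrite lerD2l -[leLHS]mulr_natl ler_wpM2r//; lra.
Qed.

(** The codes are grouped into blocks of length [N]; on block [d] one has [theta * c >= d]. Block 0
    gives [N], and the others give at most [N * expR (- (8 / p * s))] times the sum of [1/d^2],
    which is at most 2; finally [1 + x <= expR x]. *)
Lemma sum_expR_powR_le (p s theta : R) (N Q : nat) : 0 < p -> 1 <= s ->
  0 < theta -> (0 < N)%N -> 1 <= theta * N%:R ->
  \sum_(c < Q) expR (- (8 / p * s * (theta * c%:R) `^ p)) <=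
  N%:R * expR (2 * expR (- (8 / p * s))).
Proof.
move=> p0 s1 th0 N0 thN; have s0 : 0 < s := lt_le_trans ltr01 s1.
pose h (d : nat) : R := expR (- (8 / p * s * d%:R `^ p)).
have N0R : 0 < N%:R :> R by rewrite ltr0n.
apply: (@le_trans _ _ (\sum_(0 <= c < Q * N) h (c %/ N)%N)).
  rewrite -(big_mkord xpredT (fun c => expR (- (8 / p * s * (theta * c%:R) `^ p)))).
  rewrite [leRHS](@big_cat_nat _ _ _ Q)//=; last by rewrite leq_pmulr.
  rewrite -[leLHS]addr0; apply: lerD; last first.
    by apply: sumr_ge0 => c _; exact: expR_ge0.
  apply: ler_sum => c _; rewrite ler_expR lerN2 ler_wpM2l//.
    by rewrite mulr_ge0 ?divr_ge0 ?ltW.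
  rewrite ge0_ler_powR ?nnegrE ?(ltW p0) ?mulr_ge0 ?(ltW th0)//.
  apply: (@le_trans _ _ (theta * N%:R * (c %/ N)%:R)); first by rewrite ler_peMl.
  by rewrite -mulrA ler_pM2l// -natrM ler_nat mulnC leq_trunc_div.
rewrite sum_divn// ler_pM2l//.
apply: le_trans (expR_ge1Dx _).
case: Q => [|Q]; first by rewrite big_geq// addr_ge0// mulr_ge0// expR_ge0.
rewrite big_nat_recl//= {1}/h powR0 ?gt_eqF// mulr0 oppr0 expR0 lerD2l.
case: Q => [|Q]; first by rewrite big_geq// mulr_ge0// expR_ge0.
apply: (@le_trans _ _ (\sum_(0 <= d < Q.+1) expR (- (8 / p * s)) * (d.+1%:R ^+ 2)^-1)).
  by apply: ler_sum => d _; exact: expR_powR_le.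
rewrite -mulr_sumr mulrC ler_wpM2r ?expR_ge0//.
rewrite big_nat_recl//= expr1n invr1 (_ : 2 = 1 + 1)// lerD2l.
have /(_ isT isT) := @sum_inv_sqr 1 Q.+1.
rewrite big_add1/= => /le_trans; apply.
by rewrite invr1 gerBl invr_ge0.
Qed.

End Sums.

(** * Dyadic levels of coordinates *)

Section Level.

(* The [s] with [k 2^(s-1) <= i < k 2^s], truncated to [1, k]. *)
Definition level (k i : nat) : nat := minn k (trunc_log 2 (i %/ k)).+1.

Lemma level_bounds (k i : nat) : (1 <= k)%N -> (1 <= level k i <= k)%N.
Proof. by rewrite /level; lia. Qed.

Lemma level_small (k i : nat) : (i < k)%N -> level k i = 1%N.
Proof. by move=> ik; rewrite /level divn_small// trunc_log0; lia. Qed.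

Lemma level_le (k i : nat) : (1 <= k)%N -> (k <= i)%N ->
  (k * 2 ^ (level k i).-1 <= i)%N.
Proof.
move=> k1 ki; apply: (@leq_trans (k * (i %/ k))); last by rewrite mulnC leq_trunc_div.
rewrite leq_mul2l; apply/orP; right.
apply: leq_trans (trunc_logP (p := 2) _ _) => //; last by rewrite divn_gt0.
by rewrite leq_exp2l// /level; lia.
Qed.

Lemma level_gt (k i : nat) : (1 <= k)%N -> (i < k * 2 ^ k.-1)%N ->
  (i < k * 2 ^ level k i)%N.
Proof.
move=> k1 ik; rewrite /level minnE; set t := trunc_log _ _.
have [kt|kt] := leqP k t.+1.
  rewrite (_ : (k - _)%N = k); last by lia.
  by apply: leq_trans ik _; rewrite leq_mul2l leq_exp2l// leq_pred orbT.
rewrite (_ : (k - _)%N = t.+1); last by lia.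
have := trunc_log_ltn (i %/ k) (isT : (1 < 2)%N); rewrite -/t ltn_divLR//.
by rewrite mulnC.
Qed.

Lemma level_large (k i : nat) : (1 <= k)%N -> (k * 2 ^ k.-1 <= i)%N ->
  level k i = k.
Proof.
move=> k1 ki; rewrite /level; have : (k.-1 <= trunc_log 2 (i %/ k))%N.
  by apply: trunc_log_max => //; rewrite leq_divRL// mulnC.
lia.
Qed.

End Level.

(** * Rounding to signed multiples of a step *)

Section Quantizer.
Context {R : realType}.

(* Codes 2q and 2q-1 stand for the signed integers q and -q. *)
Definition quantize (g y : R) : nat :=
  let q := Num.truncn (`|y| / g) in if 0 <= y then q.*2 else q.*2.-1.

Definition unquantize (c : nat) : R :=
  if odd c then - (uphalf c)%:R else c./2%:R.

Lemma unquantizeK (g y : R) :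
  unquantize (quantize g y) = Num.sg y * (Num.truncn (`|y| / g))%:R.
Proof.
rewrite /quantize /unquantize; set q := Num.truncn _.
case: ltP => y0.
  (* For [q = 0] the predecessor truncates and the code is 0, which still decodes to 0. *)
  rewrite ltr0_sg// mulN1r; case: q => [|q]; first by rewrite /= oppr0.
  by rewrite doubleS/= odd_double/= doubleK.
rewrite odd_double doubleK; case: ltgtP y0 => // y0 _.
  by rewrite gtr0_sg// mul1r.
by rewrite /q -y0 normr0 mul0r truncn0 mulr0.
Qed.

(** Rounding is towards zero, so the error exceeds neither the step nor [|y|]; the second bound is
    what keeps the modular summable over small coordinates. *)
Lemma quantize_err (g y : R) : 0 < g ->
  `|y - g * unquantize (quantize g y)| <= Num.min g `|y|.
Proof.
move=> g0; rewrite unquantizeK; set q := Num.truncn _.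
have /andP[q1 q2] : q%:R <= `|y| / g < q.+1%:R.
  by apply: truncn_itv; rewrite divr_ge0// ltW.
rewrite ler_pdivlMr// in q1; rewrite ltr_pdivrMr// -natr1 in q2.
have -> : y - g * (Num.sg y * q%:R) = Num.sg y * (`|y| - q%:R * g).
  by rewrite {1}[y]numEsg; ring.
rewrite normrM (ger0_norm (x := _ - _)) ?subr_ge0//.
apply: (@le_trans _ _ (`|y| - q%:R * g)).
  by rewrite ler_piMl ?subr_ge0// normr_sg lern1 leq_b1.
by rewrite le_min lerBlDr gerBl mulr_ge0 ?(ltW g0)// andbT; lra.
Qed.

Lemma quantize_le (g y : R) : 0 < g -> (quantize g y)%:R <= 2 * (`|y| / g).
Proof.
move=> g0; have yg : 0 <= `|y| / g by rewrite divr_ge0// ltW.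
apply: (@le_trans _ _ (Num.truncn (`|y| / g)).*2%:R).
  by rewrite ler_nat /quantize; case: ifP => // _; exact: leq_pred.
by rewrite -mul2n natrM ler_pM2l// ; have /andP[] := truncn_itv yg.
Qed.

Lemma quantize_small (g y : R) : 0 < g -> `|y| < g -> quantize g y = 0%N.
Proof.
move=> g0 yg; rewrite /quantize (_ : Num.truncn _ = 0%N); first by case: ifP.
apply: truncn_def; rewrite divr_ge0 ?(ltW g0)//=.
by rewrite ltr_pdivrMr// mul1r.
Qed.

End Quantizer.

(** * Polynomial growth from the doubling condition *)

Section Doubling.
Context {R : realType} (C : R) (alpha : nat -> R).
Hypothesis C_ge1 : 1 <= C.

Definition doubling_exponent : R := Num.max 1 (log2 C).
(** An upper bound for the loss in replacing alpha_{i+1} by its value at the start of the level of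
    [i]; from [k] on nothing is lost. *)
Definition doubling_ratio (k i : nat) : R :=
  if (i < k)%N then C * (k%:R / i.+1%:R) `^ doubling_exponent else 1.
(** Chosen so that, for [i < k] and G the exponent above, twice the quotient of ratio and scale is
    [(sqrt (k/(i+1)) / (40 G)) ^ (2 G)]. *)
Definition doubling_scale : R :=
  2 * C * (40 * doubling_exponent) `^ (2 * doubling_exponent).

Local Notation G := doubling_exponent.

Lemma doubling_exponent_ge1 : 1 <= G.
Proof. by rewrite le_max lexx. Qed.

Let G_gt0 : 0 < G := lt_le_trans ltr01 doubling_exponent_ge1.
Let C_gt0 : 0 < C := lt_le_trans ltr01 C_ge1.

Lemma le_powR2_doubling : C <= 2 `^ G.
Proof.
apply: (@le_trans _ _ (2 `^ log2 C)); last first.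
  by rewrite ler_powR ?ler1n// le_max lexx orbT.
by rewrite /powR pnatr_eq0/= /log2 divfK ?lnK// gt_eqF// ln_gt0// ltr1n.
Qed.

Lemma doubling_ratio_ge1 (k i : nat) : 1 <= doubling_ratio k i.
Proof.
rewrite /doubling_ratio; case: ifP => // ik; rewrite mulr_ege1//.
rewrite -[leLHS](powRr0 (k%:R / i.+1%:R)) ler_powR ?(ltW G_gt0)//.
by rewrite ler_pdivlMr ?ltr0n// mul1r ler_nat.
Qed.

Lemma doubling_scale_ge1 : 1 <= doubling_scale.
Proof.
rewrite /doubling_scale !mulr_ege1// ?ler1n//.
rewrite -[leLHS](powRr0 (40 * G)) ler_powR ?mulr_ge0 ?(ltW G_gt0)//.
by rewrite mulr_ege1 ?ler1n// doubling_exponent_ge1.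
Qed.

(** If the quotient is below 1 the left side is 1. Otherwise it is at most twice the quotient, that
    is [y ^ (2 G)] with [y = sqrt z / (40 G)], and [ln y <= y] bounds this by [expR (2 G y)]. The
    square root keeps the exponents summable to order [k]. *)
Lemma truncn_doubling_le (k i : nat) : (i < k)%N ->
  (Num.truncn (doubling_ratio k i / doubling_scale)).+1%:R <=
  expR (Num.sqrt (k%:R / i.+1%:R) / 20) :> R.
Proof.
move=> ik; set z : R := k%:R / i.+1%:R.
have z1 : 1 <= z by rewrite ler_pdivlMr ?ltr0n// mul1r ler_nat.
have z0 : 0 < z := lt_le_trans ltr01 z1.
have K0 : 0 < doubling_scale := lt_le_trans ltr01 doubling_scale_ge1.
have r0 : 0 <= doubling_ratio k i / doubling_scale.
  by rewrite divr_ge0 ?(ltW K0)// (le_trans ler01) ?doubling_ratio_ge1.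
have /andP[t1 _] := truncn_itv r0.
have [r1|r1] := ltP (doubling_ratio k i / doubling_scale) 1.
  rewrite (truncn_def (n := 0)) ?r0 ?r1//=.
  by rewrite -(@expR0 R) ler_expR divr_ge0// sqrtr_ge0.
apply: (@le_trans _ _ (2 * (doubling_ratio k i / doubling_scale))).
  by rewrite -natr1; lra.
have G40 : 0 < 40 * G by rewrite pmulr_lgt0 ?ltr0n.
have sz : 0 < Num.sqrt z / (40 * G) by rewrite divr_gt0// sqrtr_gt0.
have -> : 2 * (doubling_ratio k i / doubling_scale) =
    (Num.sqrt z / (40 * G)) `^ (2 * G).
  rewrite /doubling_ratio /doubling_scale ik -/z.
  rewrite [RHS]powRM ?sqrtr_ge0 ?invr_ge0 ?(ltW G40)//.
  have -> : Num.sqrt z `^ (2 * G) = z `^ G.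
    by rewrite powRrM powR_mulrn ?sqrtr_ge0// sqr_sqrtr// ltW.
  have -> : (40 * G)^-1 `^ (2 * G) = ((40 * G) `^ (2 * G))^-1.
    by rewrite -powR_inv1 ?(ltW G40)// -powRrM mulN1r powRN.
  by field; rewrite !lt0r_neq0// powR_gt0.
rewrite /powR gt_eqF// ler_expR.
apply: (@le_trans _ _ (2 * G * (Num.sqrt z / (40 * G)))).
  by rewrite ler_pM2l ?mulr_gt0// ltW// ln_sublinear.
rewrite (_ : 2 * G * _ = Num.sqrt z / 20)//.
by field; rewrite lt0r_neq0.
Qed.

Hypothesis alpha_noninc : forall i j : nat,
  (1 <= i)%N -> (i <= j)%N -> alpha j <= alpha i.
Hypothesis alpha_ge0 : forall i : nat, (1 <= i)%N -> 0 <= alpha i.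
Hypothesis alpha_doubling : forall i : nat,
  (1 <= i)%N -> alpha i <= C * alpha (2 * i)%N.

(** Induction on [k - i], doubling [i] until [2 i >= k]. Each doubling costs [C <= 2 ^ G], which the
    change of [k / i] absorbs; the last one leaves the factor [C]. *)
Lemma doubling_le (k i : nat) : (1 <= i <= k)%N ->
  alpha i <= C * (k%:R / i%:R) `^ G * alpha k.
Proof.
have [m] := ubnP (k - i); elim: m i => // m IH i kim /andP[i1 ik].
have i0R : (0 : R) < i%:R by rewrite ltr0n.
have k1 := leq_trans i1 ik.
apply: le_trans (alpha_doubling i1) _.
rewrite -mulrA ler_pM2l//.
have [k2i|k2i] := leqP k (2 * i).
  apply: le_trans (alpha_noninc k1 k2i) _.
  rewrite ler_peMl ?alpha_ge0// -[leLHS](powRr0 (k%:R / i%:R)) ler_powR ?(ltW G_gt0)//.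
  by rewrite ler_pdivlMr// mul1r ler_nat.
apply: le_trans (IH (2 * i)%N _ _) _; [lia|lia|].
rewrite ler_wpM2r ?alpha_ge0//.
apply: (@le_trans _ _ (2 `^ G * (k%:R / (2 * i)%:R) `^ G)).
  by rewrite ler_wpM2r ?powR_ge0 ?le_powR2_doubling.
rewrite -powRM ?divr_ge0// natrM.
rewrite (_ : 2 * (k%:R / (2 * i%:R)) = k%:R / i%:R)//.
by field; rewrite lt0r_neq0.
Qed.

Lemma alpha_level_le (k i : nat) : (1 <= k)%N ->
  alpha i.+1 <= doubling_ratio k i * alpha (k * 2 ^ (level k i).-1)%N.
Proof.
move=> k1; rewrite /doubling_ratio; case: ltnP => ik.
  by rewrite level_small// muln1; apply: doubling_le; rewrite ik.
rewrite mul1r alpha_noninc//; first by rewrite muln_gt0 k1 expn_gt0.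
by rewrite ltnW// ltnS level_le.
Qed.

End Doubling.

(** * Counting the codes of bounded weight *)

Section CodeCount.
Context {R : realType} (p C : R).
Hypotheses (p_gt0 : 0 < p) (p_le1 : p <= 1) (C_ge1 : 1 <= C).

(** The quotient of scale and ratio compensates for the larger alpha_i with [i < k]; the factor
    [level k i] makes the contribution of nonzero codes summable over [i >= k]. *)
Definition code_weight (k i c : nat) : R := 8 / p * (level k i)%:R *
  (doubling_scale C / doubling_ratio C k i * c%:R) `^ p.

Lemma expR_half_le2 : expR (1 / 2) <= 2 :> R.
Proof.
have h : 1 / 2 <= expR (- (1 / 2)) :> R by have := expR_ge1Dx (- (1 / 2) : R); lra.
rewrite -[X in expR X]opprK expRN -[leRHS]invrK lef_pV2 ?posrE ?invr_gt0 ?expR_gt0//.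
by lra.
Qed.

Let level_ge1 (k i : nat) : (1 <= k)%N -> 1 <= (level k i)%:R :> R.
Proof. by move=> k1; rewrite ler1n; case/andP: (level_bounds i k1). Qed.

(** Blocks of length [N = floor (r / K) + 1] satisfy [K / r * N >= 1]. The level is 1, so the
    correction is at most [2 * 2^-8 = 1/128]. *)
Lemma code_factor_small (k i Q : nat) : (i < k)%N ->
  \sum_(c < Q) expR (- code_weight k i c) <=
  expR (Num.sqrt (k%:R / i.+1%:R) / 20 + 128^-1).
Proof.
move=> ik; have k1 : (1 <= k)%N by exact: leq_ltn_trans ik.
have r1 := doubling_ratio_ge1 C_ge1 k i; have K1 := doubling_scale_ge1 C_ge1.
set r := doubling_ratio C k i in r1 *; set K := doubling_scale C in K1 *.
have r0 : 0 < r := lt_le_trans ltr01 r1.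
have K0 : 0 < K := lt_le_trans ltr01 K1.
have rK0 : 0 <= r / K by rewrite divr_ge0// ltW.
have Kr0 : 0 < K / r by rewrite divr_gt0.
have tN : 1 <= K / r * (Num.truncn (r / K)).+1%:R.
  have /andP[_ /ltW] := truncn_itv rK0.
  by rewrite mulrAC ler_pdivlMr// mul1r ler_pdivrMr// mulrC.
have := sum_expR_powR_le Q p_gt0 (level_ge1 i k1) Kr0 (ltn0Sn _) tN.
move/le_trans; apply; rewrite expRD ler_pM ?expR_ge0//.
  exact: truncn_doubling_le.
rewrite ler_expR level_small// mulr1.
have : expR (- (8 / p)) <= 2 ^- 8.
  apply: le_trans (expRN_le 8); rewrite ler_expR lerN2 ler_pdivlMr//.
  by rewrite ler_piMr.
by rewrite (_ : 2 ^- 8 = 256^-1 :> R); [lra|rewrite -natrX].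
Qed.

(** The ratio is 1, so blocks of length 1 suffice. At level [s] the exponent is at most
    [2 * 2^-(6 + 2 s)], and [2^-s <= k / (i+1)]. *)
Lemma code_factor_large (k i Q : nat) : (1 <= k <= i)%N ->
  (i < k * 2 ^ k.-1)%N ->
  \sum_(c < Q) expR (- code_weight k i c) <=
  expR ((k%:R ^+ 2 / 32) * (i.+1%:R ^+ 2)^-1).
Proof.
move=> /andP[k1 ki] ik; have s1 := level_ge1 i k1.
have K1 := doubling_scale_ge1 C_ge1.
have r1 : doubling_ratio C k i = 1 by rewrite /doubling_ratio ltnNge ki.
have K0 : 0 < doubling_scale C / doubling_ratio C k i.
  by rewrite r1 divr1 (lt_le_trans ltr01).
have tN : 1 <= doubling_scale C / doubling_ratio C k i * 1%:R.
  by rewrite r1 divr1 mulr1.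
have := sum_expR_powR_le Q p_gt0 s1 K0 (ltn0Sn 0) tN.
move/le_trans; apply; rewrite mul1r ler_expR.
have si := level_gt k1 ik; case/andP: (level_bounds i k1) => s1' _.
move: si s1 s1'; set s := level k i => si s1 s1'.
have e1 : expR (- (8 / p * s%:R)) <= 2 ^- (6 + 2 * s).
  apply: le_trans (expRN_le _); rewrite ler_expR lerN2.
  apply: (@le_trans _ _ (8 * s%:R)); first by rewrite -natrM ler_nat; lia.
  by rewrite ler_wpM2r ?ler0n// ler_pdivlMr// ler_piMr.
have e2 : (2 ^+ s)^-1 <= k%:R / i.+1%:R :> R.
  rewrite ler_pdivlMr ?ltr0n// mulrC ler_pdivrMr ?exprn_gt0//.
  by rewrite -natrX -natrM ler_nat.
have e3 : 2 ^- (2 * s) <= k%:R ^+ 2 * (i.+1%:R ^+ 2)^-1 :> R.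
  rewrite mulnC exprM -exprVn -[(i.+1%:R ^+ 2)^-1]exprVn -exprMn.
  by rewrite lerXn2r ?nnegrE ?invr_ge0 ?exprn_ge0 ?divr_ge0.
rewrite exprD invfM (_ : 2 ^- 6 = 64^-1) in e1; last by rewrite -natrX.
rewrite [leRHS]mulrAC; move: e1 e3; move: (2 ^- (2 * s)) (_ * (_ ^- 2)) => Y X.
by move: (expR _) => E; lra.
Qed.

(** The square roots give [k/10], the constants [k/128] and the tail [k/32]. *)
Lemma sum_code_exponent (k n : nat) : (1 <= k <= n)%N ->
  \sum_(0 <= i < n) (if (i < k)%N then Num.sqrt (k%:R / i.+1%:R) / 20 + 128^-1
     else (k%:R ^+ 2 / 32) * (i.+1%:R ^+ 2)^-1) <= 3 / 16 * k%:R :> R.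
Proof.
move=> /andP[k1 kn]; rewrite (@big_cat_nat _ _ _ k)//=.
have k0R : 0 < k%:R :> R by rewrite ltr0n.
rewrite (eq_big_nat _ _ (F2 := fun i => (Num.sqrt k%:R / 20) *
    (Num.sqrt i.+1%:R)^-1 + 128^-1)); last first.
  by move=> i /andP[_ ->]; rewrite sqrtrM// sqrtrV//; ring.
rewrite [X in _ + X](eq_big_nat _ _
  (F2 := fun i => (k%:R ^+ 2 / 32) * (i.+1%:R ^+ 2)^-1)); last first.
  by move=> i /andP[ki _]; rewrite ltnNge ki.
rewrite big_split/= -!mulr_sumr sumr_const_nat subn0.
have s1 : Num.sqrt k%:R / 20 * \sum_(0 <= i < k) (Num.sqrt i.+1%:R)^-1 <=
    k%:R / 10 :> R.
  apply: (@le_trans _ _ (Num.sqrt k%:R / 20 * (2 * Num.sqrt k%:R))).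
    by rewrite ler_wpM2l ?sum_inv_sqrt// divr_ge0// sqrtr_ge0.
  have := sqr_sqrtr (ltW k0R); set x := Num.sqrt _ => <-.
  by rewrite le_eqVlt; apply/orP; left; apply/eqP; field.
have s2 : k%:R ^+ 2 / 32 * \sum_(k <= i < n) (i.+1%:R ^+ 2)^-1 <=
    k%:R / 32 :> R.
  apply: (@le_trans _ _ (k%:R ^+ 2 / 32 * k%:R^-1)).
    rewrite ler_wpM2l ?divr_ge0 ?exprn_ge0// (le_trans (sum_inv_sqr k1 kn))//.
    by rewrite gerBl invr_ge0.
  rewrite le_eqVlt; apply/orP; left; apply/eqP; field.
  by rewrite lt0r_neq0.
rewrite -[128^-1 *+ k]mulr_natr.
lra.
Qed.

Lemma card_codes (k Q : nat) : (1 <= k)%N ->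
  (#|[pred f : {ffun 'I_(k * 2 ^ k.-1) -> 'I_Q} |
      (\sum_(i < k * 2 ^ k.-1) code_weight k i (f i) <= k%:R / 16)%R]| <= 2 ^ k.-1)%N.
Proof.
move=> k1; set n := (k * 2 ^ k.-1)%N.
have kn : (k <= n)%N by rewrite leq_pmulr// expn_gt0.
have cnt : #|[pred f : {ffun 'I_n -> 'I_Q} |
    \sum_(i < k * 2 ^ k.-1) code_weight k i (f i) <= k%:R / 16]|%:R <=
    expR (1 / 4) ^+ k :> R.
  have := @card_weight_le R 'I_n 'I_Q (fun i c => code_weight k i c) (k%:R / 16).
  move/le_trans; apply.
  apply: (@le_trans _ _ (expR (k%:R / 16) * expR (3 / 16 * k%:R))); last first.
    rewrite -expRD -expRM_natl ler_expR.
    by rewrite le_eqVlt; apply/orP; left; apply/eqP; field.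
  rewrite ler_pM2l ?expR_gt0//.
  have k1n : (1 <= k <= n)%N by rewrite k1.
  have := sum_code_exponent k1n; rewrite -ler_expR => /(le_trans _); apply.
  rewrite expR_sum big_mkord; apply: ler_prod => i _.
  rewrite sumr_ge0/=; last by move=> c _; exact: expR_ge0.
  case: ltnP => ik; first exact: code_factor_small.
  by apply: code_factor_large; rewrite ?k1.
have e0 : expR (1 / 4) <= 4 / 3 :> R.
  have h : 3 / 4 <= expR (- (1 / 4)) :> R by have := expR_ge1Dx (- (1 / 4) : R); lra.
  rewrite -[X in expR X]opprK expRN -[leRHS]invrK.
  by rewrite lef_pV2 ?posrE ?invr_gt0 ?expR_gt0// invf_div.
have e00 : 0 <= expR (1 / 4) :> R := expR_ge0 _.
(* For [k = 1] the integer count is at most [4/3 < 2], hence at most 1. For [k >= 2], [(4/3)^2 <= 2]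
   pays for the missing factor in [2 ^ (k - 1)]. *)
case: k k1 @n {kn} cnt => // -[_ n cnt|k _ n cnt].
  rewrite -ltnS -(ltr_nat R); apply: le_lt_trans cnt _.
  by rewrite expr1; lra.
rewrite -(ler_nat R); apply: le_trans cnt _; rewrite natrX/=.
rewrite !exprS mulrA ler_pM ?mulr_ge0 ?exprn_ge0//; first by nra.
by rewrite lerXn2r ?nnegrE//; lra.
Qed.

End CodeCount.

(** * The rounding constant and its comparison with [c2] *)

Section Constants.
Context {R : realType} (p C : R).
Hypotheses (p_gt0 : 0 < p) (p_le1 : p <= 1) (C_ge1 : 1 <= C).

(** The 2 offsets the factor in [quantize_le], the scale cancels the one in [code_weight], and the
    p-th power of the middle factor turns [8 / p] into [1/32]. *)
Definition step_const : R := 2 * (256 / p) `^ p^-1 * doubling_scale C.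

Lemma ln2_ge_half : 1 / 2 <= ln 2 :> R.
Proof. by rewrite -[leLHS]expRK ler_ln ?posrE ?expR_gt0// expR_half_le2. Qed.

(** From [1 + ln (C/2) <= C/2] and [ln 2 >= 1/2]. *)
Lemma doubling_exponent_le : doubling_exponent C <= C.
Proof.
have C0 : 0 < C := lt_le_trans ltr01 C_ge1.
rewrite ge_max C_ge1/= /log2 ler_pdivrMr ?ln_gt0 ?ltr1n//.
have h2 := ln2_ge_half.
have C2 : 0 < C / 2 by rewrite divr_gt0.
have h : 1 + ln (C / 2) <= C / 2.
  by rewrite -[leRHS]lnK ?posrE// expR_ge1Dx.
rewrite ln_div ?posrE// in h.
move: h h2; move: (ln C) (ln 2) => a b h h2.
have C1 : 0 <= C - 1 by rewrite subr_ge0.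
have b2 : 0 <= b - 1 / 2 by rewrite subr_ge0.
by have := mulr_ge0 C1 b2; lra.
Qed.

Lemma doubling_exponent_le_log2 :
  doubling_exponent C <= log2 (24 * (p^-1 + C)).
Proof.
have C0 : 0 < C := lt_le_trans ltr01 C_ge1.
have pV : 0 < p^-1 by rewrite invr_gt0.
have h : 2 <= 24 * (p^-1 + C).
  by move: C_ge1 pV; move: (p^-1) => u C1 u0; lra.
have hC : C <= 24 * (p^-1 + C) by move: (p^-1) pV => u u0; lra.
rewrite ge_max log2_ge1//=.
rewrite /log2 ler_pM2r ?invr_gt0 ?ln_gt0 ?ltr1n// ler_ln ?posrE//.
exact: lt_le_trans h.
Qed.

Lemma step_const_gt1 : 1 < step_const.
Proof.
have K1 := doubling_scale_ge1 C_ge1.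
have e1 : 1 <= (256 / p) `^ p^-1.
  rewrite -[leLHS](powRr0 (256 / p)) ler_powR ?invr_ge0 ?(ltW p_gt0)//.
  by rewrite ler_pdivlMr// mul1r (le_trans p_le1)// ler1n.
apply: (@lt_le_trans _ _ 2); first by rewrite ltr1n.
by rewrite /step_const -mulrA ler_peMr// mulr_ege1.
Qed.

(** Factor by factor, with G the doubling exponent: [40 <= 2^7] and [G <= C] give [2 ^ (14 C)],
    [G <= log2 (24 (1/p + C))] gives the logarithmic factor, and the powers of [2 ^ (1/p)] have
    ample room. *)
Lemma step_const_le_c2 : 2 * 2 `^ p^-1 * step_const <= c2 p C.
Proof.
have z2 := powR2V_ge2 p_gt0 p_le1.
have C0 : 0 < C := lt_le_trans ltr01 C_ge1.
have pV : 0 < p^-1 by rewrite invr_gt0.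
have pV1 : 1 <= p^-1 by rewrite -invr1 lef_pV2 ?posrE.
have G1 := doubling_exponent_ge1 C; have GC := doubling_exponent_le.
have Gl := doubling_exponent_le_log2.
rewrite /c2 /step_const /doubling_scale.
set G := doubling_exponent C in G1 GC Gl *; set l := log2 _ in Gl *.
have G0 : 0 < G := lt_le_trans ltr01 G1.
have l0 : 0 < l := lt_le_trans G0 Gl.
have l1 : 1 <= l := le_trans G1 Gl.
have -> : (256 / p) `^ p^-1 = (2 `^ p^-1) ^+ 8 * p^-1 `^ p^-1.
  by rewrite powRM ?(ltW pV)// -powR_exp//; congr (_ `^ _ * _); rewrite -natrX.
rewrite powR_natM// (powRM _ (x := 40)) ?(ltW G0)//.
set z := 2 `^ p^-1 in z2 *; have z0 : 0 < z by exact: lt_le_trans z2.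
have h1 : 40 `^ (2 * G) <= 2 `^ (14 * C).
  apply: (@le_trans _ _ ((2 ^+ 7) `^ (2 * G))).
    rewrite ge0_ler_powR ?nnegrE ?mulr_ge0 ?(ltW G0) ?exprn_ge0//.
    by rewrite -natrX ler_nat.
  rewrite -powR_mulrn// -powRrM ler_powR ?ler1n// mulrA -natrM.
  by rewrite ler_wpM2l.
have h2 : G `^ (2 * G) <= l `^ (2 * (p^-1 + C)).
  apply: (@le_trans _ _ (l `^ (2 * G))).
    by apply: ge0_ler_powR; rewrite ?nnegrE ?(ltW G0) ?(ltW l0)// mulr_ge0// ltW.
  by rewrite ler_powR//; lra.
have h3 : p^-1 `^ p^-1 <= (p^-1 + C) `^ (p^-1 + C).
  apply: (@le_trans _ _ ((p^-1 + C) `^ p^-1)).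
    by rewrite ge0_ler_powR ?nnegrE ?addr_ge0 ?(ltW pV) ?(ltW C0)// lerDl ltW.
  by rewrite ler_powR//; lra.
have h4 : 8 * z ^+ 9 <= 4 * z ^+ 22.
  rewrite (_ : 8 * z ^+ 9 = 4 * (2 * z ^+ 9)); last by ring.
  rewrite ler_pM2l//; apply: (@le_trans _ _ (z ^+ 10)).
    by rewrite [leRHS]exprS ler_wpM2r// exprn_ge0// ltW.
  by rewrite ler_weXn2l// (le_trans _ z2)// ler1n.
have -> : 2 * z * (2 * (z ^+ 8 * p^-1 `^ p^-1) *
    (2 * C * (40 `^ (2 * G) * G `^ (2 * G)))) =
    C * (8 * z ^+ 9) * 40 `^ (2 * G) * G `^ (2 * G) * p^-1 `^ p^-1 by ring.
have -> : 4 * C * z ^+ 22 = C * (4 * z ^+ 22) by ring.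
have C8 : 0 <= C * (8 * z ^+ 9) by rewrite !mulr_ge0 ?exprn_ge0 ?(ltW C0) ?(ltW z0).
apply: (ler_pM _ _ _ h3); last first.
- apply: (ler_pM _ _ _ h2); last first.
  + by apply: (ler_pM _ _ _ h1); [exact: C8|exact: powR_ge0|rewrite ler_pM2l].
  + exact: powR_ge0.
  + exact: mulr_ge0 C8 (powR_ge0 _ _).
- exact: powR_ge0.
- exact: mulr_ge0 (mulr_ge0 C8 (powR_ge0 _ _)) (powR_ge0 _ _).
Qed.

End Constants.

(** * The upper estimate by rounding *)

Lemma sum_ltn_le {R : realType} (k n : nat) :
  \sum_(0 <= i < n) (i < k)%:R <= k%:R :> R.
Proof.
rewrite -natr_sum ler_nat -big_mkcond/= sum1_count -size_filter.
rewrite -[leqRHS](size_iota 0); apply: uniq_leq_size.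
  by rewrite filter_uniq// iota_uniq.
by move=> i; rewrite mem_filter mem_iota => /andP[].
Qed.

Lemma orlicz_space_finite_support {R : realType} (p : R) (M : R -> R)
    (n : nat) (x : nat -> R) : 0 < p -> p_orlicz_function p M ->
  (forall i, (n <= i)%N -> x i = 0) -> orlicz_space M x.
Proof.
move=> p0 hM xn; pose rho := 1 + \sum_(i < n) `|x i|.
have S0 : 0 <= \sum_(i < n) `|x i| by exact: sumr_ge0.
have r0 : 0 < rho by rewrite ltr_pwDl.
have xr i : `|x i| <= rho.
  have [ni|ni] := leqP n i; first by rewrite xn// normr0 ltW.
  apply: (@le_trans _ _ (\sum_(i < n) `|x i|)); last by rewrite lerDr.
  by rewrite (bigD1 (Ordinal ni))//= lerDl sumr_ge0.
exists rho => //; apply: (@le_lt_trans _ _ n%:R%:E); last by rewrite ltry.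
apply: (orlicz_modular_le_partial p0 hM r0 xr) => m.
apply: le_trans (sum_ltn_le n m); apply: ler_sum => i _.
have [ni|ni] := leqP n i; first by rewrite xn// normr0 mul0r (orlicz0 p0).
have : `|x i| / rho \in `[0, 1].
  by rewrite in_itv/= divr_ge0 ?(ltW r0)//= ler_pdivrMr// mul1r.
by move/(orlicz_unit_itv p0 hM); rewrite in_itv => /andP[].
Qed.

Section EntropyUpperBound.
Context {R : realType} (p C : R) (M1 M2 : R -> R) (alpha : nat -> R).
Hypotheses (p_gt0 : 0 < p) (p_le1 : p <= 1) (C_ge1 : 1 <= C).
Hypotheses (M1_orlicz : p_orlicz_function p M1).
Hypotheses (M2_orlicz : p_orlicz_function p M2).
Hypothesis alpha_ge0 : forall i : nat, (1 <= i)%N -> 0 <= alpha i.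
Hypothesis alpha_noninc : forall i j : nat,
  (1 <= i)%N -> (i <= j)%N -> alpha j <= alpha i.
Hypothesis alpha_doubling : forall i : nat,
  (1 <= i)%N -> alpha i <= C * alpha (2 * i)%N.

Local Notation phi1 := (fundamental_function M1).
Local Notation phi2 := (fundamental_function M2).
Local Notation K := (step_const p C).

Hypothesis phi_ratio_nondec : forall s t : R, 1 <= s -> s <= t ->
  phi1 s / phi2 s <= phi1 t / phi2 t.

Variables (k : nat) (L : R).
Hypotheses (k_ge1 : (1 <= k)%N) (L_gt0 : 0 < L).
Hypothesis Lambda_le : Lambda M1 M2 alpha k <= L.

Definition block_size (i : nat) : R := k%:R / (level k i)%:R.
Definition step (i : nat) : R := K * L / phi2 (block_size i).

Lemma block_size_ge1 (i : nat) : 1 <= block_size i.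
Proof.
have /andP[s1 sk] := level_bounds i k_ge1.
by rewrite ler_pdivlMr ?ltr0n// mul1r ler_nat.
Qed.

Let f1 (i : nat) : 0 < phi1 (block_size i).
Proof. exact: fundamental_gt0 p_gt0 M1_orlicz _ (block_size_ge1 i). Qed.

Let f2 (i : nat) : 0 < phi2 (block_size i).
Proof. exact: fundamental_gt0 p_gt0 M2_orlicz _ (block_size_ge1 i). Qed.

Let K_gt1 : 1 < K := step_const_gt1 p_gt0 p_le1 C_ge1.
Let K_gt0 : 0 < K := lt_trans ltr01 K_gt1.
Let KL_gt0 : 0 < K * L := mulr_gt0 K_gt0 L_gt0.

Lemma step_gt0 (i : nat) : 0 < step i.
Proof. exact: divr_gt0 KL_gt0 (f2 i). Qed.

(** The term of [Lambda] with [s = level k i] bounds alpha at the start of the level, and the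
    doubling ratio carries this to [i+1]. *)
Lemma alpha_le_fundamental (i : nat) : alpha i.+1 <=
  doubling_ratio C k i * (L * (phi1 (block_size i) / phi2 (block_size i))).
Proof.
have := alpha_level_le C_ge1 alpha_noninc alpha_ge0 alpha_doubling i k_ge1.
move/le_trans; apply.
have r1 := doubling_ratio_ge1 C_ge1 k i.
rewrite ler_pM2l; last exact: lt_le_trans r1.
have := Lambda_ge_term M1 M2 alpha (level_bounds i k_ge1).
move/le_trans => /(_ _ Lambda_le); rewrite /Lambda_term -/(block_size i).
by rewrite mulrA ler_pdivrMr// -ler_pdivlMr// => /le_trans; apply; rewrite mulrA.
Qed.

Lemma alpha_le_fundamental_large (i : nat) : (k <= i)%N ->
  alpha i.+1 <= L * (phi1 (block_size i) / phi2 (block_size i)).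
Proof.
move=> ki; have := alpha_le_fundamental i.
by rewrite /doubling_ratio ltnNge ki mul1r.
Qed.

(* If |x| < 1 / phi1(k/s), write |x| = 1 / phi1 t with t >= k/s and compare
   the ratios phi1 / phi2 at k/s and at t. *)
Lemma error_modular_le (i : nat) (x e : R) : `|x| <= 1 -> `|e| <= step i ->
  `|e| <= alpha i.+1 * `|x| ->
  M2 (`|e| / (K * L)) <= (i < k)%:R / k%:R + M1 `|x|.
Proof.
move=> x1 eg ex.
have x01 : `|x| \in `[0, 1] by rewrite in_itv/= normr_ge0.
have /andP[M1x0 _] : 0 <= M1 `|x| <= 1.
  by have := orlicz_unit_itv p_gt0 M1_orlicz x01; rewrite in_itv.
have phi2V := fundamentalV_unit p_gt0 M2_orlicz (block_size_ge1 i).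
have eKL : `|e| / (K * L) <= (phi2 (block_size i))^-1.
  by rewrite ler_pdivrMr// mulrC.
have bsV : (level k i)%:R / k%:R = (block_size i)^-1 by rewrite invf_div.
have e0 : 0 <= `|e| / (K * L) by rewrite divr_ge0// ltW.
have e01 : `|e| / (K * L) \in `[0, 1].
  move: phi2V; rewrite !in_itv/= e0 => /andP[_]; exact: le_trans.
have Me : M2 (`|e| / (K * L)) <= (level k i)%:R / k%:R.
  rewrite bsV -(orlicz_fundamentalV p_gt0 M2_orlicz (block_size_ge1 i)).
  exact: (orlicz_le p_gt0).
(* Below [k] the level is 1, so the bound [level / k] is the indicator term [1/k]. *)
have [ik|ki] := ltnP i k.
  by apply: le_trans Me _; rewrite level_small// lerDl.
rewrite mul0r add0r.
have phi1V := fundamentalV_unit p_gt0 M1_orlicz (block_size_ge1 i).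
have [xbig|xsmall] := leP (phi1 (block_size i))^-1 `|x|.
  apply: le_trans Me _.
  rewrite bsV -(orlicz_fundamentalV p_gt0 M1_orlicz (block_size_ge1 i)).
  exact: (orlicz_le p_gt0).
have [x0|x0] := eqVneq x 0.
  have -> : e = 0.
    by apply/eqP; rewrite -normr_le0 (le_trans ex)// x0 normr0 mulr0.
  by rewrite normr0 mul0r x0 normr0 (orlicz0 p_gt0)// (orlicz0 p_gt0).
have x0' : 0 < `|x| by rewrite normr_gt0.
have M1x : 0 < M1 `|x| by exact: (orlicz_gt0 p_gt0).
pose t := (M1 `|x|)^-1.
have kt : block_size i <= t.
  rewrite -[block_size i]invrK lef_pV2 ?posrE ?invr_gt0//; last first.
    exact: lt_le_trans (block_size_ge1 i).
  rewrite -(orlicz_fundamentalV p_gt0 M1_orlicz (block_size_ge1 i)).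
  by apply: (orlicz_le p_gt0) => //; exact: ltW.
have t1 : 1 <= t := le_trans (block_size_ge1 i) kt.
have xE : `|x| = (phi1 t)^-1.
  apply: (orlicz_inj p_gt0 M1_orlicz) => //.
    exact: (fundamentalV_unit p_gt0).
  by rewrite (orlicz_fundamentalV p_gt0)// /t invrK.
have g1 : 0 < phi1 t by exact: (fundamental_gt0 p_gt0).
have g2 : 0 < phi2 t by exact: (fundamental_gt0 p_gt0).
rewrite -[M1 _]invrK -/t -(orlicz_fundamentalV p_gt0 M2_orlicz t1).
apply: (orlicz_le p_gt0) => //; first exact: (fundamentalV_unit p_gt0).
rewrite ler_pdivrMr//; apply: le_trans ex _.
apply: (@le_trans _ _ (L * (phi1 t / phi2 t) * `|x|)).
  rewrite ler_wpM2r// (le_trans (alpha_le_fundamental_large ki))//.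
  by rewrite ler_pM2l// phi_ratio_nondec// block_size_ge1.
rewrite xE (_ : L * (phi1 t / phi2 t) / phi1 t = (phi2 t)^-1 * L); last first.
  by field; rewrite !lt0r_neq0.
have g2V : 0 < (phi2 t)^-1 by rewrite invr_gt0.
by rewrite ler_pM2l// ler_peMl ?(ltW L_gt0)// ltW.
Qed.

(** With [a = |x| phi1 (k/s)] the weight is at most [s a^p / 32]. If [a >= 1], dilation of [M1] by
    [1/a] gives [s a^p <= k M1 |x|]. If [a < 1], then either [i < k] and [s a^p <= 1], or the
    coordinate is below one step and its code is 0. *)
Lemma code_weight_le (i : nat) (x : R) : `|x| <= 1 ->
  code_weight p C k i (quantize (step i) (alpha i.+1 * x)) <=
  32^-1 * ((i < k)%:R + k%:R * M1 `|x|).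
Proof.
move=> x1; set c := quantize _ _.
have x01 : `|x| \in `[0, 1] by rewrite in_itv/= normr_ge0.
have /andP[M1x0 _] : 0 <= M1 `|x| <= 1.
  by have := orlicz_unit_itv p_gt0 M1_orlicz x01; rewrite in_itv.
pose a := `|x| * phi1 (block_size i).
have a0 : 0 <= a by exact: mulr_ge0 (normr_ge0 _) (ltW (f1 i)).
have r1 := doubling_ratio_ge1 C_ge1 k i; have S1 := doubling_scale_ge1 C_ge1.
have r0 : 0 < doubling_ratio C k i := lt_le_trans ltr01 r1.
have S0 : 0 < doubling_scale C := lt_le_trans ltr01 S1.
have y_le : `|alpha i.+1 * x| <= doubling_ratio C k i * a * (L / phi2 (block_size i)).
  rewrite normrM ger0_norm ?alpha_ge0//.
  apply: (@le_trans _ _ (doubling_ratio C k i *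
    (L * (phi1 (block_size i) / phi2 (block_size i))) * `|x|)).
    by rewrite ler_wpM2r// alpha_le_fundamental.
  by rewrite /a le_eqVlt; apply/orP; left; apply/eqP; ring.
have s1 : (1 <= level k i)%N by case/andP: (level_bounds i k_ge1).
have main : code_weight p C k i c <= 32^-1 * ((level k i)%:R * a `^ p).
  have c_le : c%:R <= 2 * (doubling_ratio C k i * a / K).
    apply: le_trans (quantize_le _ (step_gt0 i)) _; rewrite ler_pM2l//.
    rewrite ler_pdivrMr ?step_gt0//; apply: le_trans y_le _.
    rewrite /step le_eqVlt; apply/orP; left; apply/eqP; field.
    by rewrite (lt0r_neq0 (f2 i)) (lt0r_neq0 K_gt0).
  pose B := (256 / p) `^ p^-1.
  have p256 : 0 <= 256 / p by rewrite divr_ge0// ltW.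
  have B0 : 0 < B by rewrite powR_gt0// divr_gt0.
  have sc : doubling_scale C / doubling_ratio C k i * c%:R <= a / B.
    apply: (@le_trans _ _ (doubling_scale C / doubling_ratio C k i *
        (2 * (doubling_ratio C k i * a / K)))).
      by rewrite ler_wpM2l// divr_ge0// ltW.
    rewrite /step_const -/B le_eqVlt; apply/orP; left; apply/eqP; field.
    by rewrite (lt0r_neq0 B0) (lt0r_neq0 S0) (lt0r_neq0 r0).
  have BV0 : 0 < B^-1 by rewrite invr_gt0.
  rewrite /code_weight.
  apply: (@le_trans _ _ (8 / p * (level k i)%:R * (a / B) `^ p)).
    apply: ler_wpM2l; first by rewrite mulr_ge0// divr_ge0// ltW.
    apply: ge0_ler_powR => //; rewrite ?nnegrE ?(ltW p_gt0)//.
      by rewrite mulr_ge0// divr_ge0// ltW.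
    by rewrite mulr_ge0// ltW.
  rewrite (powRM _ a0 (ltW BV0)) -[B^-1 `^ p](_ : (B `^ p)^-1 = _); last first.
    by rewrite -powRN -mulN1r powRrM powR_inv1// ltW.
  rewrite /B powR_Kinv// le_eqVlt; apply/orP; left; apply/eqP; field.
  exact: lt0r_neq0.
have [a1|a1] := leP 1 a.
  apply: le_trans main _; rewrite ler_pM2l ?invr_gt0//.
  apply: (@le_trans _ _ (k%:R * M1 `|x|)); last by rewrite lerDr.
  have ap : 0 < a `^ p by rewrite powR_gt0// (lt_le_trans ltr01).
  have a0' : 0 < a := lt_le_trans ltr01 a1.
  have aV : a^-1 \in `[0, 1] by rewrite in_itv/= invr_ge0 a0 invf_le1.
  have := orlicz_dilate p_gt0 M1_orlicz aV x01.
  have x0 : `|x| != 0.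
    by apply: contraTN a1 => /eqP x0; rewrite /a x0 mul0r -ltNge ltr01.
  have -> : a^-1 * `|x| = (phi1 (block_size i))^-1.
    by rewrite /a; field; rewrite x0 (lt0r_neq0 (f1 i)).
  rewrite (orlicz_fundamentalV p_gt0)// ?block_size_ge1//.
  have -> : a^-1 `^ p = (a `^ p)^-1 by rewrite -powRN -mulN1r powRrM powR_inv1.
  rewrite [leRHS]mulrC ler_pdivlMr//.
  rewrite /block_size invf_div mulrAC ler_pdivrMr ?ltr0n//.
  by rewrite [M1 _ * _]mulrC.
have [ik|ki] := ltnP i k.
  apply: le_trans main _; rewrite ler_pM2l ?invr_gt0//.
  rewrite level_small// mul1r; apply: (@le_trans _ _ 1); last first.
    by rewrite lerDl mulr_ge0.
  have := ge0_ler_powR (ltW p_gt0); move=> /(_ a 1); rewrite !nnegrE powR1.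
  by apply => //; exact: ltW.
have c0 : c = 0%N.
  apply: quantize_small; first exact: step_gt0.
  apply: le_lt_trans y_le _; rewrite /doubling_ratio ltnNge ki/= mul1r.
  have Lphi : 0 < L / phi2 (block_size i) by exact: divr_gt0.
  rewrite /step -mulrA ltr_pM2r//; exact: lt_trans K_gt1.
rewrite /code_weight c0 mulr0 powR0 ?gt_eqF// mulr0.
by rewrite mulr_ge0 ?invr_ge0// addr_ge0// mulr_ge0.
Qed.

Lemma code_error_le (i : nat) (x : R) : `|x| <= 1 ->
  let y := alpha i.+1 * x in
  let v := if (i < k * 2 ^ k.-1)%N then
    step i * unquantize (quantize (step i) y) else 0 in
  `|y - v| <= step i /\ `|y - v| <= alpha i.+1 * `|x|.
Proof.
move=> x1 y v; have yE : `|y| = alpha i.+1 * `|x|.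
  by rewrite /y normrM ger0_norm ?alpha_ge0.
rewrite /v; case: ltnP => ik.
  have := quantize_err y (step_gt0 i).
  by rewrite le_min -yE => /andP[].
(* Coordinates from [k 2^(k-1)] on are replaced by 0: there [block_size] is 1, so alpha is at most
   [L], which is below the step [K L]. *)
rewrite subr0 yE; split=> //.
have b1 : block_size i = 1.
  by rewrite /block_size level_large// mulfV// pnatr_eq0 -lt0n.
have ki : (k <= i)%N by apply: leq_trans ik; rewrite leq_pmulr// expn_gt0.
have := alpha_le_fundamental_large ki.
rewrite /step b1 !(fundamental1 p_gt0)// divr1 mulr1 divr1 => aL.
apply: (@le_trans _ _ (L * 1)); first by rewrite ler_pM ?alpha_ge0.
by rewrite mulr1 ler_peMl ?(ltW L_gt0)// ltW.
Qed.

Lemma entropy_le_step_const :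
  (diagonal_entropy_number M1 M2 alpha k <= (2 * 2 `^ p^-1 * K * L)%:E)%E.
Proof.
(* The 2 comes from halving [x], and [z] lowers the modular of the error from 2 to 1. *)
set z := 2 `^ p^-1; set eps := 2 * z * K * L.
have z0 : 0 < z by rewrite powR_gt0.
have k0R : 0 < k%:R :> R by rewrite ltr0n.
have eps0 : 0 < eps by rewrite /eps -mulrA; apply: mulr_gt0 => //; exact: mulr_gt0.
pose n := (k * 2 ^ k.-1)%N.
(* A bound for every code that can occur, so that the alphabet is finite. *)
pose Q := \max_(i < n) Num.truncn (2 * (alpha i.+1 / step i)).
pose center (f : {ffun 'I_n -> 'I_Q.+1}) (i : nat) : R :=
  if insub i is Some j then 2 * (step i * unquantize (f j : nat)) else 0.
pose V := [pred f : {ffun 'I_n -> 'I_Q.+1} |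
  \sum_(i < n) code_weight p C k i (f i) <= k%:R / 16].
have cardV : (#|V| <= 2 ^ k.-1)%N by exact: card_codes.
pose f0 : {ffun 'I_n -> 'I_Q.+1} := [ffun=> ord0].
apply: ge_ereal_inf; exists eps%:E => //; exists eps => //; split=> //.
(* [V] may have fewer than [2 ^ (k-1)] members; the remaining indices receive the centre of [f0]. *)
exists (fun j => center (nth f0 (enum V) j)); split.
  move=> j; apply: (@orlicz_space_finite_support _ _ _ n _ p_gt0 M2_orlicz) => i ni.
  by rewrite /center insubN// -leqNgt.
move=> _ [x [xsp x1] <-].
have m2 : (orlicz_modular M1 x 2 <= 1)%E.
  apply: (orlicz_norm_lt_modular p_gt0 M1_orlicz xsp).
  by apply: le_lt_trans x1 _; rewrite ltr1n.
have [x2 xsum] := orlicz_modular_partial_le p_gt0 M1_orlicz (ltr0n _ 2) m2.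
pose x' i : R := x i / 2.
have x'E i : `|x' i| = `|x i| / 2 by rewrite normrM normfV normr_nat.
have x'1 i : `|x' i| <= 1 by rewrite x'E ler_pdivrMr// mul1r.
have M1x' i : 0 <= M1 `|x' i|.
  have : `|x' i| \in `[0, 1] by rewrite in_itv/= normr_ge0 x'1.
  by move/(orlicz_unit_itv p_gt0 M1_orlicz); rewrite in_itv => /andP[].
have {}xsum m : \sum_(0 <= i < m) M1 `|x' i| <= 1.
  by apply: le_trans (xsum m); apply: ler_sum => i _; rewrite x'E.
pose q i := quantize (step i) (alpha i.+1 * x' i).
have qQ (j : 'I_n) : (q j < Q.+1)%N.
  rewrite ltnS; apply: leq_trans (leq_bigmax j).
  have s0 := step_gt0 j.
  have as0 : 0 <= alpha j.+1 / step j by rewrite divr_ge0 ?alpha_ge0// ltW.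
  rewrite truncn_ge_nat; last exact: mulr_ge0.
  apply: le_trans (quantize_le _ s0) _; rewrite ler_pM2l// ler_pM2r ?invr_gt0//.
  by rewrite normrM ger0_norm ?alpha_ge0// ler_piMr ?alpha_ge0.
pose f : {ffun 'I_n -> 'I_Q.+1} := [ffun j : 'I_n => inord (q j)].
have fE (j : 'I_n) : f j = q j :> nat by rewrite ffunE inordK// qQ.
have Vf : f \in V.
  rewrite inE; apply: (@le_trans _ _
    (\sum_(i < n) 32^-1 * ((i < k)%:R + k%:R * M1 `|x' i|))).
    by apply: ler_sum => j _; rewrite fE; exact: code_weight_le.
  rewrite -(big_mkord xpredT (fun i => 32^-1 * ((i < k)%:R + k%:R * M1 `|x' i|))).
  rewrite -mulr_sumr big_split/= -mulr_sumr.
  have h1 := @sum_ltn_le R k n.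
  have h2 : k%:R * \sum_(0 <= i < n) M1 `|x' i| <= k%:R by rewrite ler_piMr.
  (* One [k] counts the coordinates below [k], the other comes from the modular of [x']. *)
  rewrite (_ : k%:R / 16 = 32^-1 * (k%:R + k%:R)); last by field.
  by rewrite ler_pM2l ?invr_gt0// lerD.
have jlt : (index f (enum V) < 2 ^ k.-1)%N.
  by apply: leq_trans cardV; rewrite cardE index_mem mem_enum.
exists (Ordinal jlt) => //=; rewrite nth_index ?mem_enum//.
exists (fun i => eps^-1 * (diagonal_operator alpha x i - center f i)); last first.
  apply/funext => i /=; rewrite !fctE /GRing.scale/= mulrA mulfV ?gt_eqF// mul1r.
  by rewrite addrC subrK.
pose v i := if (i < n)%N then
  step i * unquantize (quantize (step i) (alpha i.+1 * x' i)) else 0.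
have vE i : center f i = 2 * v i.
  rewrite /center /v; case: insubP => [j _ ji|/negbTE->]; last by rewrite mulr0.
  by rewrite fE -ji ltn_ord.
have KL0 : 0 < K * L by exact: mulr_gt0.
pose u i := `|alpha i.+1 * x' i - v i| / (K * L).
have bE i : `|eps^-1 * (diagonal_operator alpha x i - center f i)| = z^-1 * u i.
  rewrite vE normrM gtr0_norm ?invr_gt0// /u.
  have -> : diagonal_operator alpha x i - 2 * v i = 2 * (alpha i.+1 * x' i - v i).
    by rewrite /diagonal_operator /x'; field.
  rewrite normrM normr_nat /eps; field.
  by rewrite (lt0r_neq0 z0) (lt0r_neq0 K_gt0) (lt0r_neq0 L_gt0).
have z1 : 1 <= z by apply: le_trans (powR2V_ge2 p_gt0 p_le1); rewrite ler1n.
have zV : z^-1 \in `[0, 1] by rewrite in_itv/= invr_ge0 (ltW z0) invf_le1.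
have u01 i : u i \in `[0, 1].
  have [e1 _] := code_error_le i (x'1 i).
  rewrite in_itv/= divr_ge0 ?(ltW KL0)//= ler_pdivrMr// mul1r.
  apply: le_trans e1 _; rewrite ler_pdivrMr// ler_peMr ?(ltW KL0)//.
  exact: (fundamental_ge1 p_gt0 M2_orlicz (block_size_ge1 i)).
apply: (orlicz_modular_le1_norm (M := M2)) => //.
apply: (orlicz_modular_le_partial p_gt0 M2_orlicz) => // [i|m].
  rewrite bE; move: zV (u01 i); rewrite !in_itv/= => /andP[? ?] /andP[? ?].
  exact: mulr_ile1.
apply: (@le_trans _ _
  (\sum_(0 <= i < m) 2^-1 * (k%:R^-1 * (i < k)%:R + M1 `|x' i|))).
  apply: ler_sum => i _; rewrite divr1 bE.
  apply: le_trans (orlicz_dilate p_gt0 M2_orlicz zV (u01 i)) _.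
  have -> : z^-1 `^ p = 2^-1.
    by rewrite -powR_inv1 ?(ltW z0)// powRAC /z powR_Kinv// powR_inv1.
  rewrite ler_pM2l ?invr_gt0// [k%:R^-1 * _]mulrC.
  have [e1 e2] := code_error_le i (x'1 i).
  exact: error_modular_le (x'1 i) e1 e2.
rewrite -mulr_sumr big_split/= -mulr_sumr.
have h1 : k%:R^-1 * \sum_(0 <= i < m) (i < k)%:R <= 1 :> R.
  by rewrite mulrC ler_pdivrMr// mul1r sum_ltn_le.
by have := xsum m; lra.
Qed.

End EntropyUpperBound.

Theorem corollary4p4 (R : realType) (p : R) (M1 M2 : R -> R)
    (alpha : nat -> R) (C : R)
    (p_gt0 : 0 < p) (p_le1 : p <= 1)
    (hM1 : p_orlicz_function p M1) (hM2 : p_orlicz_function p M2)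
    (alpha_ge0 : forall i : nat, (1 <= i)%N -> 0 <= alpha i)
    (alpha_noninc : forall i j : nat,
       (1 <= i)%N -> (i <= j)%N -> alpha j <= alpha i)
    (C_ge1 : 1 <= C)
    (alpha_doubling : forall i : nat,
       (1 <= i)%N -> alpha i <= C * alpha (2 * i)%N)
    (phi_ratio_nondec : forall s t : R, 1 <= s -> s <= t ->
       fundamental_function M1 s / fundamental_function M2 s <=
       fundamental_function M1 t / fundamental_function M2 t)
    (k : nat) (k_ge1 : (1 <= k)%N) :
  ((c1 p * Lambda M1 M2 alpha k)%:E <=
     diagonal_entropy_number M1 M2 alpha k)%E /\
  (diagonal_entropy_number M1 M2 alpha k <=
     (c2 p C * Lambda M1 M2 alpha k)%:E)%E.
Proof.
split; first exact: (entropy_ge_Lambda p_gt0 p_le1 hM1 hM2).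
have k1R : 1 <= k%:R / 1%:R :> R by rewrite divr1 ler1n.
have Lambda_ge0 : 0 <= Lambda M1 M2 alpha k.
  have k11 : (1 <= 1 <= k)%N by [].
  apply: le_trans (Lambda_ge_term M1 M2 alpha k11).
  apply: mulr_ge0; first by rewrite alpha_ge0// muln1.
  by rewrite ltW// divr_gt0 ?(fundamental_gt0 p_gt0 hM1) ?(fundamental_gt0 p_gt0 hM2).
set c := 2 * 2 `^ p^-1 * step_const p C.
have c_gt0 : 0 < c.
  have K0 : 0 < step_const p C.
    by apply: lt_trans (step_const_gt1 p_gt0 p_le1 C_ge1).
  by apply: mulr_gt0 K0; rewrite mulr_gt0// powR_gt0.
(* [Lambda] may vanish while the rounding step has to be positive, so the estimate is applied with
   [L = Lambda + e / c] for arbitrary [e > 0]. *)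
apply/lee_addgt0Pr => e e0.
have ec : 0 < e / c by rewrite divr_gt0.
have L0 : 0 < Lambda M1 M2 alpha k + e / c by rewrite ltr_wpDl.
have LL : Lambda M1 M2 alpha k <= Lambda M1 M2 alpha k + e / c by rewrite lerDl ltW.
apply: le_trans (entropy_le_step_const p_gt0 p_le1 C_ge1 hM1 hM2 alpha_ge0
  alpha_noninc alpha_doubling phi_ratio_nondec k_ge1 L0 LL) _.
rewrite -/c -EFinD lee_fin mulrDr (mulrC c (e / c)) divfK ?gt_eqF// lerD2r.
by rewrite ler_wpM2r// step_const_le_c2.
Qed.
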